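(* Let \(X, Y \subseteq \operatorname{Homeo}_+(I)\) be geometrically fast sets, each having only finitely many transition points, and suppose their dynamical diagrams \(D_X\) and \(D_Y\) are isomorphic. Let \(\tau : X \to Y\) be the bijection between edge labels induced by the isomorphism. Then \(\tau\) extends to an isomorphism \(\phi : \langle X\rangle \to \langle Y\rangle\). Moreover, there is an order preserving bijection \(\theta : M\langle X\rangle \to M\langle Y\rangle\) such that for every \(f \in \langle X\rangle\) and every \(t \in M\langle X\rangle\), \((tf)\theta = (t\theta)\phi(f)\); i.e. \(f \mapsto f^\theta = \theta^{-1} f \theta\) induces the isomorphism \(\langle X\rangle \cong \langle Y\rangle\).
   Context: \(I=[0,1]\) and \(\operatorname{Homeo}_+(I)\) is the group of orientation preserving homeomorphisms of \(I\), acting on the right: \(tg\) denotes the image of \(t\) under \(g\), and \(fg\) means apply \(f\) first. The support of \(f\) is \(\operatorname{supt}(f)=\{t\in I : tf\neq t\}\); an orbital of \(f\) is a connected component of \(\operatorname{supt}(f)\). A left (right) transition point of \(f\) is a point \(t\notin\operatorname{supt}(f)\) such that for every \(\epsilon>0\), \((t,t+\epsilon)\cap\operatorname{supt}(f)\neq\emptyset\) (resp. \((t-\epsilon,t)\cap\operatorname{supt}(f)\neq\emptyset\)). A transition point of a set is a transition point of one of its elements. A bump is an element of \(\operatorname{Homeo}_+(I)\) with exactly one orbital; it is positive if \(ta>t\) on its support. A bump \(b\) is a signed bump of \(f\) if \(b\) agrees with \(f\) on \(\operatorname{supt}(b)\). A positive bump \(a\) is used in \(X\subseteq\operatorname{Homeo}_+(I)\)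 if some \(f\in X\) agrees with \(a\) or with \(a^{-1}\) on \(\operatorname{supt}(a)\). A set \(X\subseteq \operatorname{Homeo}_+(I)\) is geometrically proper if no point of \(I\) is a left transition point of two distinct elements of \(X\) and no point is a right transition point of two distinct elements of \(X\). A marking of a geometrically proper set \(A\) of positive bumps assigns to each \(a\in A\) a marker \(t\in\operatorname{supt}(a)\); if \(a\) has orbital \((x,y)\) and marker \(t\), its source is \(\operatorname{src}(a)=(x,t)\) and destination is \(\operatorname{dest}(a)=[ta,y)\), and \(\operatorname{src}(a^{-1}):=\operatorname{dest}(a)\), \(\operatorname{dest}(a^{-1}):=\operatorname{src}(a)\); these intervals are the feet. \(A\) is geometrically fast if it is geometrically proper and has a marking for which all feet of elements of \(A\) are pairwise disjoint. A set \(X\subseteq\operatorname{Homeo}_+(I)\) is geometrically fast if it is geometrically proper and the set of bumps used in \(X\) is geometrically fast. Dynamical diagram: for geometrically fast \(X\) with finitely many transition points (marking the bumps used in \(X\) so that the feet are disjoint), \(D_X\) is the directed graph whose vertices are the feet, linearly ordered by the order of \(I\), whose edges are the signed bumps of elements of \(X\), each directed from its source to its destination and labeled by the element of \(X\) it comes from. An isomorphism of dynamical diagrams is an order preserving bijection of vertices which is a directed graph isomorphism and induces a bijection between the label sets (two edges have equal labels iff their images do). Canonical marking and \(M\langle X\rangle\): let \(A\) be the finite set of bumps used in \(X\). An element of \(A\) is isolated if its support contains no transition point of \(A\); \(a\in A\) is initial if it is isolated or the least transition point of \(A\) in \(\operatorname{supt}(a)\) is not a right transition point of any element of \(A\). Enumerate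 \(A=\{a_0,\dots,a_n\}\) with increasing left transition points; let \(s_k\) be the least transition point of \(A\) in \(\operatorname{supt}(a_k)\) (the midpoint of \(\operatorname{supt}(a_k)\) if \(a_k\) is isolated); set \(t_k=s_k\) if \(a_k\) is initial, and otherwise \(t_k=t_ja_j\) where \(s_k\) is the right transition point of \(a_j\), \(j<k\). The marking \(a_k\mapsto t_k\) is the canonical marking. \(M_X\) is the set of \(t_k\) with \(a_k\) initial, and \(M\langle X\rangle=\{tg : t\in M_X,\ g\in\langle X\rangle\}\); similarly for \(Y\). *)

(* Defs.v *)
From Stdlib Require Import Reals List.
Open Scope R_scope.

Definition inI (t : R) : Prop := 0 <= t <= 1.

(* Elements of Homeo_+(I) are represented as functions R -> R that restrict to
   an orientation preserving homeomorphism of I and are the identity outside I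
   (so that equality of elements is plain function equality). *)
Definition homeo_plus (f : R -> R) : Prop :=
  (forall t, ~ inI t -> f t = t) /\
  (forall t, inI t -> inI (f t)) /\
  (forall s t, inI s -> inI t -> s < t -> f s < f t) /\
  (forall u, inI u -> exists t, inI t /\ f t = u) /\
  (forall t, inI t -> forall eps, 0 < eps ->
     exists delta, 0 < delta /\
       forall s, inI s -> Rabs (s - t) < delta -> Rabs (f s - f t) < eps).

(* Right action: t g = g t; the product f g means "apply f first". *)
Definition mul (f g : R -> R) : R -> R := fun t => g (f t).

Inductive gen (X : (R -> R) -> Prop) : (R -> R) -> Prop :=
  | gen_id : gen X (fun t => t)
  | gen_mul : forall g x, gen X g -> X x -> gen X (mul g x)
  | gen_mulinv : forall g x h, gen X g -> X x ->
      (forall t, h (x t) = t) -> (forall t, x (h t) = t) -> gen X (mul g h).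

Definition supt (f : R -> R) (t : R) : Prop := inI t /\ f t <> t.

(* (x,y) is an orbital of f: a connected component of supt f. *)
Definition orbital (f : R -> R) (x y : R) : Prop :=
  0 <= x /\ x < y /\ y <= 1 /\ f x = x /\ f y = y /\
  (forall t, x < t < y -> f t <> t).

Definition left_tp (f : R -> R) (t : R) : Prop :=
  inI t /\ ~ supt f t /\
  forall eps, 0 < eps -> exists s, t < s < t + eps /\ supt f s.

Definition right_tp (f : R -> R) (t : R) : Prop :=
  inI t /\ ~ supt f t /\
  forall eps, 0 < eps -> exists s, t - eps < s < t /\ supt f s.

Definition bump (a : R -> R) : Prop :=
  homeo_plus a /\
  exists x y, orbital a x y /\ forall x' y', orbital a x' y' -> x' = x /\ y' = y.

Definition pos_bump (a : R -> R) : Prop :=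
  bump a /\ forall t, supt a t -> t < a t.

Definition agrees (f a : R -> R) : Prop := forall t, supt a t -> f t = a t.
Definition agrees_inv (f a : R -> R) : Prop := forall t, supt a t -> a (f t) = t.

Definition used (X : (R -> R) -> Prop) (a : R -> R) : Prop :=
  pos_bump a /\ exists f, X f /\ (agrees f a \/ agrees_inv f a).

Definition geom_proper (X : (R -> R) -> Prop) : Prop :=
  (forall t f g, X f -> X g -> left_tp f t -> left_tp g t -> f = g) /\
  (forall t f g, X f -> X g -> right_tp f t -> right_tp g t -> f = g).

Definition marking (A : (R -> R) -> Prop) (m : (R -> R) -> R) : Prop :=
  forall a, A a -> supt a (m a).

(* Feet: k = true is the source (x, m a), k = false the destination [(m a) a, y). *)
Definition foot (m : (R -> R) -> R) (v : (R -> R) * bool) (s : R) : Prop :=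
  let (a, k) := v in
  exists x y, orbital a x y /\
    (if k then x < s < m a else a (m a) <= s < y).

Definition feet_disjoint (A : (R -> R) -> Prop) (m : (R -> R) -> R) : Prop :=
  forall u v, A (fst u) -> A (fst v) -> u <> v ->
    forall s, ~ (foot m u s /\ foot m v s).

Definition fast_marking (A : (R -> R) -> Prop) (m : (R -> R) -> R) : Prop :=
  marking A m /\ feet_disjoint A m.

Definition geom_fast_bumps (A : (R -> R) -> Prop) : Prop :=
  geom_proper A /\ exists m, fast_marking A m.

Definition geom_fast (X : (R -> R) -> Prop) : Prop :=
  geom_proper X /\ geom_fast_bumps (used X).

Definition transition_pt (X : (R -> R) -> Prop) (t : R) : Prop :=
  exists f, X f /\ (left_tp f t \/ right_tp f t).

Definition finitely_many_tp (X : (R -> R) -> Prop) : Prop :=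
  exists l : list R, forall t, transition_pt X t -> In t l.

(* Vertices: feet, indexed by (a, k) with a a used bump. *)
Definition vertex (X : (R -> R) -> Prop) (v : (R -> R) * bool) : Prop := used X (fst v).

Definition foot_lt (m : (R -> R) -> R) (u v : (R -> R) * bool) : Prop :=
  forall s t, foot m u s -> foot m v t -> s < t.

(* Edge from u to v labelled f: a signed bump of f in X (either the positive bump
   a, from src a to dest a, or a^{-1}, from dest a to src a). *)
Definition edge (X : (R -> R) -> Prop) (u v : (R -> R) * bool) (f : R -> R) : Prop :=
  X f /\ exists a, pos_bump a /\
    ((agrees f a /\ u = (a, true) /\ v = (a, false)) \/
     (agrees_inv f a /\ u = (a, false) /\ v = (a, true))).

Definition label (X : (R -> R) -> Prop) (f : R -> R) : Prop :=
  exists u v, edge X u v f.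

Definition diagram_iso (X Y : (R -> R) -> Prop) (mX mY : (R -> R) -> R)
    (beta : (R -> R) * bool -> (R -> R) * bool) (tau : (R -> R) -> (R -> R)) : Prop :=
  (forall u, vertex X u -> vertex Y (beta u)) /\
  (forall u v, vertex X u -> vertex X v -> beta u = beta v -> u = v) /\
  (forall w, vertex Y w -> exists u, vertex X u /\ beta u = w) /\
  (forall u v, vertex X u -> vertex X v -> foot_lt mX u v -> foot_lt mY (beta u) (beta v)) /\
  (forall u v f, edge X u v f -> edge Y (beta u) (beta v) (tau f)) /\
  (forall u v g, vertex X u -> vertex X v -> edge Y (beta u) (beta v) g ->
     exists f, edge X u v f /\ tau f = g) /\
  (forall f f', label X f -> label X f' -> tau f = tau f' -> f = f').

Definition tpA (A : (R -> R) -> Prop) (t : R) : Prop :=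
  exists a, A a /\ (left_tp a t \/ right_tp a t).

Definition isolated (A : (R -> R) -> Prop) (a : R -> R) : Prop :=
  ~ exists t, supt a t /\ tpA A t.

Definition least_tp (A : (R -> R) -> Prop) (a : R -> R) (s : R) : Prop :=
  supt a s /\ tpA A s /\ forall t, supt a t -> tpA A t -> s <= t.

Definition s_of (A : (R -> R) -> Prop) (a : R -> R) (s : R) : Prop :=
  (isolated A a /\ exists x y, orbital a x y /\ s = (x + y) / 2) \/
  (~ isolated A a /\ least_tp A a s).

Definition initial (A : (R -> R) -> Prop) (a : R -> R) : Prop :=
  isolated A a \/
  exists s, least_tp A a s /\ ~ exists b, A b /\ right_tp b s.

(* M_X: canonical markers t_k of initial bumps (for initial a_k, t_k = s_k). *)
Definition M0 (X : (R -> R) -> Prop) (t : R) : Prop :=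
  exists a, used X a /\ initial (used X) a /\ s_of (used X) a t.

Definition Mgen (X : (R -> R) -> Prop) (t : R) : Prop :=
  exists g s, gen X g /\ M0 X s /\ t = g s.

Definition group_iso (X Y : (R -> R) -> Prop) (phi : (R -> R) -> (R -> R)) : Prop :=
  (forall f, gen X f -> gen Y (phi f)) /\
  (forall f g, gen X f -> gen X g -> phi (mul f g) = mul (phi f) (phi g)) /\
  (forall f g, gen X f -> gen X g -> phi f = phi g -> f = g) /\
  (forall h, gen Y h -> exists f, gen X f /\ phi f = h).

(* Main.v *)
Require Import Defs.
From Stdlib Require Import Reals List.
From Stdlib Require Import Lra Classical ClassicalEpsilon FunctionalExtensionality.
Import ListNotations.
Open Scope R_scope.

(** Write a bump a as lft < mrk < img < rgt with img = a(mrk): its feet are the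
    source (lft, mrk) and the destination [img, rgt).  Disjointness of the feet
    amounts to three families of inequalities between these numbers, and the order
    of the feet is determined by comparing transition points only.  A letter maps
    the complement of its source in its support onto its destination, so a point
    obtained from a base marker by letters acting off their sources remembers these
    letters: the foot containing it tells the last one (ping-pong).  Running the
    same letters from corresponding base markers of X and Y pairs up points of the
    two intervals.  Paired points have the same place among the feet, pairs are
    preserved by the generators, and comparing two pairs reduces, by undoing a
    common last letter, to comparing base markers or points in different places.
    This gives theta.

    For phi it remains to see that a word fixing all paired points of one side is
    the identity.  If the word moves t, follow the trajectory of t back to the point
    c with the shortest history; any q with the same place as c is moved along the
    same bumps.  Such a q can be found among the paired points and their limits from
    below; here the canonical marking is needed, since it leaves no gap after the
    source of a non-initial bump.  Uniqueness of histories shows that the word does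
    not fix the translate of q, a contradiction. *)

(** * Increasing bijections of the line, and extrema over finite lists *)

Definition incbij (f : R -> R) : Prop :=
  (forall s t, s < t -> f s < f t) /\ (forall u, exists t, f t = u).

Lemma incbij_inj (f : R -> R) (s t : R) : incbij f -> f s = f t -> s = t.
Proof.
  intros [Hf _] H. destruct (Rtotal_order s t) as [C|[C|C]]; auto;
    apply Hf in C; lra.
Qed.

Lemma incbij_lt_inv (f : R -> R) (s t : R) : incbij f -> f s < f t -> s < t.
Proof.
  intros [Hf _] H. destruct (Rtotal_order s t) as [C|[C|C]]; auto.
  - subst; lra.
  - apply Hf in C; lra.
Qed.

Lemma incbij_le (f : R -> R) (s t : R) : incbij f -> s <= t -> f s <= f t.
Proof.
  intros [Hf _] [H|H]; [left; auto | subst; lra].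
Qed.

Lemma incbij_mul (f g : R -> R) : incbij f -> incbij g -> incbij (mul f g).
Proof.
  intros [Hf Sf] [Hg Sg]. unfold mul. split; [auto|].
  intros u. destruct (Sg u) as [v Hv]. destruct (Sf v) as [w Hw].
  exists w. now rewrite Hw.
Qed.

Lemma incbij_inverse (f : R -> R) :
  incbij f -> exists h, (forall t, h (f t) = t) /\ (forall t, f (h t) = t).
Proof.
  intros Hf. exists (fun u => epsilon (inhabits 0) (fun t => f t = u)).
  assert (H : forall u, f (epsilon (inhabits 0) (fun t => f t = u)) = u).
  { intros u. apply (epsilon_spec (inhabits 0) (fun t => f t = u)). apply Hf. }
  split; [|exact H].
  intros t. apply (incbij_inj f); auto.
Qed.

Lemma incbij_of_inverse (f h : R -> R) :
  incbij f -> (forall t, h (f t) = t) -> (forall t, f (h t) = t) -> incbij h.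
Proof.
  intros Hf H1 H2. split.
  - intros s t C. apply (incbij_lt_inv f); auto. now rewrite !H2.
  - intros u. exists (f u). apply H1.
Qed.

Lemma list_max {T : Type} (v : T -> R) (P : T -> Prop) (l : list T) :
  (exists a, In a l /\ P a) ->
  exists a, In a l /\ P a /\ forall b, In b l -> P b -> v b <= v a.
Proof.
  induction l as [|a l IH]; intros (c & Hc & Pc); [destruct Hc|].
  destruct (classic (exists b, In b l /\ P b)) as [Hl|Hl].
  - destruct (IH Hl) as (m & Hm & Pm & Mm).
    destruct (classic (P a /\ v m < v a)) as [[Pa Hv]|Hn].
    + exists a. split; [now left|split; auto].
      intros b [<-|Hb] Pb; [lra|]. specialize (Mm b Hb Pb). lra.
    + exists m. split; [now right|split; auto].
      intros b [<-|Hb] Pb; auto. apply Rnot_lt_le. tauto.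
  - exists c. split; auto. split; auto. intros b Hb Pb.
    destruct Hc as [<-|Hc]; [|exfalso; eauto].
    destruct Hb as [<-|Hb]; [lra|exfalso; eauto].
Qed.

Lemma list_min {T : Type} (v : T -> R) (P : T -> Prop) (l : list T) :
  (exists a, In a l /\ P a) ->
  exists a, In a l /\ P a /\ forall b, In b l -> P b -> v a <= v b.
Proof.
  intros H. destruct (list_max (fun a => - v a) P l H) as (a & Ha & Pa & Ma).
  exists a. split; auto. split; auto. intros b Hb Pb. specialize (Ma b Hb Pb). lra.
Qed.

(** * Ping-pong *)

Section PingPong.

Context {I J : Type}.

(** The combinatorial data common to X and Y. Bumps and labels are mere indices, so that one diagram
    can have several realizations. The sign k in [incid f a k] tells whether f acts on the support
    of a as a or as its inverse. *)
Record diagram := {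
  isbump : I -> Prop;
  islabel : J -> Prop;
  incid : J -> I -> bool -> Prop;
  ini : I -> Prop;
  prv : I -> I -> Prop }.

Record system := {
  gact : J -> R -> R;
  bmp : I -> R -> R;
  lft : I -> R;
  mrk : I -> R;
  img : I -> R;
  rgt : I -> R }.

(** [rz_src], [rz_dst] and [rz_src_dst] express that the feet are disjoint. The strict inequality of
    [rz_ini] keeps initial markers out of all destinations, and [rz_prv] is the recursion of the
    canonical marking. *)
Record realizes (D : diagram) (S : system) : Prop := {
  rz_chain : forall a, isbump D a ->
    lft S a < mrk S a /\ mrk S a < img S a /\ img S a < rgt S a;
  rz_lft_inj : forall a b, isbump D a -> isbump D b -> lft S a = lft S b -> a = b;
  rz_rgt_inj : forall a b, isbump D a -> isbump D b -> rgt S a = rgt S b -> a = b;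
  rz_src : forall a b, isbump D a -> isbump D b ->
    lft S a < lft S b -> mrk S a <= lft S b;
  rz_dst : forall a b, isbump D a -> isbump D b ->
    rgt S a < rgt S b -> rgt S a <= img S b;
  rz_src_dst : forall a b, isbump D a -> isbump D b ->
    lft S a < rgt S b -> mrk S a <= img S b;
  rz_ini : forall a b, isbump D a -> isbump D b -> ini D a ->
    lft S a < rgt S b -> mrk S a < img S b;
  rz_prv_ex : forall a, isbump D a -> ~ ini D a -> exists b, isbump D b /\ prv D a b;
  rz_prv : forall a b, isbump D a -> isbump D b -> prv D a b ->
    lft S b < lft S a /\ lft S a < rgt S b /\ mrk S a = img S b;
  rz_bmp_inc : forall a, isbump D a -> incbij (bmp S a);
  rz_bmp_lft : forall a, isbump D a -> bmp S a (lft S a) = lft S a;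
  rz_bmp_rgt : forall a, isbump D a -> bmp S a (rgt S a) = rgt S a;
  rz_bmp_mrk : forall a, isbump D a -> bmp S a (mrk S a) = img S a;
  rz_bmp_pos : forall a p, isbump D a -> lft S a < p < rgt S a -> p < bmp S a p;
  rz_gact_inc : forall f, islabel D f -> incbij (gact S f);
  rz_gact_pos : forall f a p, isbump D a -> incid D f a true ->
    lft S a < p < rgt S a -> gact S f p = bmp S a p;
  rz_gact_neg : forall f a p, isbump D a -> incid D f a false ->
    lft S a < p < rgt S a -> bmp S a (gact S f p) = p;
  rz_gact_fix : forall f p, islabel D f ->
    (forall a k, isbump D a -> incid D f a k -> ~ lft S a < p < rgt S a) ->
    gact S f p = p }.

(* The comparisons that determine the order of the feet of a fast marking. *)
Definition compatible (D : diagram) (S S' : system) : Prop :=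
  forall a b, isbump D a -> isbump D b ->
    (lft S a < lft S b <-> lft S' a < lft S' b) /\
    (rgt S a < rgt S b <-> rgt S' a < rgt S' b) /\
    (lft S a < rgt S b <-> lft S' a < rgt S' b).

Lemma compatible_sym (D : diagram) (S S' : system) :
  compatible D S S' -> compatible D S' S.
Proof.
  intros H a b Ha Hb. destruct (H a b Ha Hb) as (H1 & H2 & H3). tauto.
Qed.

Lemma compatible_refl (D : diagram) (S : system) : compatible D S S.
Proof. intros a b _ _. tauto. Qed.

(** The mix of [<=] and [<] follows the shape of the feet, (lft, mrk) and [img, rgt): p and q lie in
    corresponding feet or in corresponding gaps. *)
Definition same_place (D : diagram) (S S' : system) (p q : R) : Prop :=
  forall a, isbump D a ->
    (p <= lft S a <-> q <= lft S' a) /\ (p < mrk S a <-> q < mrk S' a) /\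
    (p < img S a <-> q < img S' a) /\ (p < rgt S a <-> q < rgt S' a).

(* A letter (a, true) stands for the bump a and (a, false) for its inverse;
   [land] is the destination of the letter and [step] its action off its source. *)
Definition land (D : diagram) (S : system) (c : I * bool) (p : R) : Prop :=
  let (a, k) := c in
  isbump D a /\ if k then img S a <= p < rgt S a else lft S a < p < mrk S a.

(** A relation, so that an inverse letter is described by [bmp] itself instead of an inverse
    function. *)
Definition act (S : system) (c : I * bool) (p p' : R) : Prop :=
  let (a, k) := c in if k then p' = bmp S a p else bmp S a p' = p.

(** The support of the letter without its source. The source of (a, true) is the destination of (a,
    false), and conversely. *)
Definition dom (D : diagram) (S : system) (c : I * bool) (p : R) : Prop :=
  let (a, k) := c in
  isbump D a /\ if k then mrk S a <= p < rgt S a else lft S a < p < img S a.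

Definition step (D : diagram) (S : system) (c : I * bool) (p p' : R) : Prop :=
  dom D S c p /\ act S c p p'.

(** * Letters and feet in a single system *)

Section OneSystem.

Variables (D : diagram) (S : system).
Hypothesis rz : realizes D S.

Lemma bmp_supt (a : I) (p : R) :
  isbump D a -> (lft S a < p < rgt S a <-> lft S a < bmp S a p < rgt S a).
Proof.
  intros Ha. pose proof (rz_bmp_inc D S rz a Ha) as Hi.
  rewrite <- (rz_bmp_lft D S rz a Ha) at 2. rewrite <- (rz_bmp_rgt D S rz a Ha) at 2.
  split; intros [H1 H2]; split; try (apply Hi; assumption);
    apply (incbij_lt_inv _ _ _ Hi); assumption.
Qed.

Lemma act_exists (c : I * bool) (p : R) : isbump D (fst c) -> exists p', act S c p p'.
Proof.
  destruct c as [a []]; simpl; intros Ha; [eauto|].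
  apply (rz_bmp_inc D S rz a Ha).
Qed.

Lemma act_fun (c : I * bool) (p p' p'' : R) :
  isbump D (fst c) -> act S c p p' -> act S c p p'' -> p' = p''.
Proof.
  destruct c as [a []]; simpl; intros Ha H1 H2; [congruence|].
  apply (incbij_inj _ _ _ (rz_bmp_inc D S rz a Ha)). congruence.
Qed.

Lemma act_back_fun (c : I * bool) (p p' p0 : R) :
  isbump D (fst c) -> act S c p p0 -> act S c p' p0 -> p = p'.
Proof.
  destruct c as [a []]; simpl; intros Ha H1 H2; [|congruence].
  apply (incbij_inj _ _ _ (rz_bmp_inc D S rz a Ha)). congruence.
Qed.

Lemma act_lt (c : I * bool) (p p' q q' : R) :
  isbump D (fst c) -> act S c p p' -> act S c q q' -> (p < q <-> p' < q').
Proof.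
  destruct c as [a []]; simpl; intros Ha H1 H2; subst;
    pose proof (rz_bmp_inc D S rz a Ha) as Hi;
    split; intros; try (now apply Hi); now apply (incbij_lt_inv _ _ _ Hi).
Qed.

Lemma act_negb (a : I) (k : bool) (p p' : R) : act S (a, k) p p' <-> act S (a, negb k) p' p.
Proof. destruct k; simpl; split; auto. Qed.

Lemma dom_bump (c : I * bool) (p : R) : dom D S c p -> isbump D (fst c).
Proof. destruct c; simpl; tauto. Qed.

Lemma step_land (c : I * bool) (p p' : R) : step D S c p p' -> land D S c p'.
Proof.
  unfold step. destruct c as [a []]; simpl; intros [[Ha H1] H2]; split; auto;
    pose proof (rz_bmp_inc D S rz a Ha) as Hi; pose proof (rz_chain D S rz a Ha).
  - subst p'. split.
    + rewrite <- (rz_bmp_mrk D S rz a Ha). apply (incbij_le _ _ _ Hi); lra.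
    + rewrite <- (rz_bmp_rgt D S rz a Ha). apply Hi; lra.
  - split; apply (incbij_lt_inv _ _ _ Hi).
    + rewrite (rz_bmp_lft D S rz a Ha); lra.
    + rewrite (rz_bmp_mrk D S rz a Ha); lra.
Qed.

Lemma step_exists (c : I * bool) (p : R) : dom D S c p -> exists p', step D S c p p'.
Proof.
  intros H. destruct (act_exists c p (dom_bump _ _ H)) as [p' Hp]. exists p'. split; auto.
Qed.

(** Disjointness of the feet; this is what allows a history to be read backwards. *)
Lemma land_unique (c c' : I * bool) (p : R) : land D S c p -> land D S c' p -> c = c'.
Proof.
  destruct c as [a k], c' as [b j]; simpl. intros [Ha H1] [Hb H2].
  pose proof (rz_chain D S rz a Ha) as Ca. pose proof (rz_chain D S rz b Hb) as Cb.
  destruct k, j.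
  - f_equal. apply (rz_rgt_inj D S rz); auto.
    destruct (Rtotal_order (rgt S a) (rgt S b)) as [C|[C|C]]; auto;
      apply (rz_dst D S rz) in C; auto; lra.
  - exfalso. assert (C : lft S b < rgt S a) by lra.
    apply (rz_src_dst D S rz) in C; auto; lra.
  - exfalso. assert (C : lft S a < rgt S b) by lra.
    apply (rz_src_dst D S rz) in C; auto; lra.
  - f_equal. apply (rz_lft_inj D S rz); auto.
    destruct (Rtotal_order (lft S a) (lft S b)) as [C|[C|C]]; auto;
      apply (rz_src D S rz) in C; auto; lra.
Qed.

(** Initial markers are starting points without history: [rz_ini] excludes the destinations, and a
    marker bounds its own source without belonging to it. *)
Lemma ini_mrk_not_land (a : I) (c : I * bool) :
  isbump D a -> ini D a -> ~ land D S c (mrk S a).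
Proof.
  intros Ha Hi. pose proof (rz_chain D S rz a Ha) as Ca.
  destruct c as [b []]; simpl; intros [Hb H];
    pose proof (rz_chain D S rz b Hb) as Cb.
  - assert (C : lft S a < rgt S b) by lra. apply (rz_ini D S rz) in C; auto; lra.
  - destruct (Rtotal_order (lft S a) (lft S b)) as [C|[C|C]].
    + apply (rz_src D S rz) in C; auto; lra.
    + apply (rz_lft_inj D S rz) in C; auto; subst; lra.
    + apply (rz_src D S rz) in C; auto; lra.
Qed.

End OneSystem.

(** * Corresponding points of two compatible systems *)

Section TwoSystems.

Variables (D : diagram) (S S' : system).
Hypotheses (rz : realizes D S) (rz' : realizes D S') (cp : compatible D S S').

(** A foot lies entirely on one side of every end of another foot, and compatibility makes that side
    the same in both systems. *)
Lemma same_place_land (c : I * bool) (p q : R) :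
  land D S c p -> land D S' c q -> same_place D S S' p q.
Proof.
  destruct c as [a k]; simpl. intros [Ha H1] [_ H2] b Hb.
  pose proof (rz_chain D S rz a Ha) as Ca. pose proof (rz_chain D S rz b Hb) as Cb.
  pose proof (rz_chain D S' rz' a Ha) as Ca'. pose proof (rz_chain D S' rz' b Hb) as Cb'.
  destruct (cp a b Ha Hb) as (Ol & Or & Olr). destruct (cp b a Hb Ha) as (Ol2 & Or2 & Orl).
  destruct k.
  - destruct (Rlt_or_le (lft S b) (rgt S a)) as [C1|C1];
      [assert (C1' := proj1 Orl C1); pose proof (rz_src_dst D S rz b a Hb Ha C1);
       pose proof (rz_src_dst D S' rz' b a Hb Ha C1')
      |assert (C1' : ~ lft S' b < rgt S' a) by (intros X; apply Orl in X; lra)];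
    (destruct (Rtotal_order (rgt S a) (rgt S b)) as [C2|[C2|C2]];
      [assert (C2' := proj1 Or C2); pose proof (rz_dst D S rz a b Ha Hb C2);
       pose proof (rz_dst D S' rz' a b Ha Hb C2')
      |apply (rz_rgt_inj D S rz) in C2; auto; subst b
      |assert (C2' := proj1 Or2 C2); pose proof (rz_dst D S rz b a Hb Ha C2);
       pose proof (rz_dst D S' rz' b a Hb Ha C2')]); repeat split; intros; lra.
  - destruct (Rlt_or_le (lft S a) (rgt S b)) as [C1|C1];
      [assert (C1' := proj1 Olr C1); pose proof (rz_src_dst D S rz a b Ha Hb C1);
       pose proof (rz_src_dst D S' rz' a b Ha Hb C1')
      |assert (C1' : ~ lft S' a < rgt S' b) by (intros X; apply Olr in X; lra)];
    (destruct (Rtotal_order (lft S a) (lft S b)) as [C2|[C2|C2]];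
      [assert (C2' := proj1 Ol C2); pose proof (rz_src D S rz a b Ha Hb C2);
       pose proof (rz_src D S' rz' a b Ha Hb C2')
      |apply (rz_lft_inj D S rz) in C2; auto; subst b
      |assert (C2' := proj1 Ol2 C2); pose proof (rz_src D S rz b a Hb Ha C2);
       pose proof (rz_src D S' rz' b a Hb Ha C2')]); repeat split; intros; lra.
Qed.

Lemma same_place_mrk (a : I) :
  isbump D a -> ini D a -> same_place D S S' (mrk S a) (mrk S' a).
Proof.
  intros Ha Hi b Hb.
  pose proof (rz_chain D S rz a Ha) as Ca. pose proof (rz_chain D S rz b Hb) as Cb.
  pose proof (rz_chain D S' rz' a Ha) as Ca'. pose proof (rz_chain D S' rz' b Hb) as Cb'.
  destruct (cp a b Ha Hb) as (Ol & Or & Olr). destruct (cp b a Hb Ha) as (Ol2 & Or2 & Orl).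
  destruct (Rlt_or_le (lft S a) (rgt S b)) as [C1|C1];
      [assert (C1' := proj1 Olr C1); pose proof (rz_ini D S rz a b Ha Hb Hi C1);
       pose proof (rz_ini D S' rz' a b Ha Hb Hi C1')
      |assert (C1' : ~ lft S' a < rgt S' b) by (intros X; apply Olr in X; lra)];
    (destruct (Rtotal_order (lft S a) (lft S b)) as [C2|[C2|C2]];
      [assert (C2' := proj1 Ol C2); pose proof (rz_src D S rz a b Ha Hb C2);
       pose proof (rz_src D S' rz' a b Ha Hb C2')
      |apply (rz_lft_inj D S rz) in C2; auto; subst b
      |assert (C2' := proj1 Ol2 C2); pose proof (rz_src D S rz b a Hb Ha C2);
       pose proof (rz_src D S' rz' b a Hb Ha C2')]); repeat split; intros; lra.
Qed.

Lemma same_place_supt (a : I) (p q : R) :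
  same_place D S S' p q -> isbump D a ->
  (lft S a < p < rgt S a <-> lft S' a < q < rgt S' a).
Proof.
  intros H Ha. destruct (H a Ha) as (H1 & H2 & H3 & H4).
  split; intros [C1 C2]; split; try tauto; apply Rnot_le_lt; intros C;
    apply H1 in C; lra.
Qed.

Lemma same_place_dom (c : I * bool) (p q : R) :
  same_place D S S' p q -> dom D S c p -> dom D S' c q.
Proof.
  destruct c as [a k]; simpl. intros H [Ha Hd]. split; auto.
  destruct (H a Ha) as (H1 & H2 & H3 & H4).
  destruct k; destruct Hd as [C1 C2]; split; try tauto.
  - apply Rnot_lt_le. intros C; apply H2 in C; lra.
  - apply Rnot_le_lt. intros C; apply H1 in C; lra.
Qed.

Lemma same_place_step (c : I * bool) (p q p' q' : R) :
  step D S c p p' -> step D S' c q q' -> same_place D S S' p' q'.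
Proof.
  intros H1 H2. apply (same_place_land c).
  - apply (step_land D S rz c p); auto.
  - apply (step_land D S' rz' c q); auto.
Qed.

(* Pairs of points with the same finite history from the base markers. *)
Inductive paired : R -> R -> Prop :=
  | paired_mrk : forall a, isbump D a -> ini D a -> paired (mrk S a) (mrk S' a)
  | paired_step : forall c p q p' q', paired p q ->
      step D S c p p' -> step D S' c q q' -> paired p' q'.

Lemma paired_same_place (p q : R) : paired p q -> same_place D S S' p q.
Proof.
  intros H. destruct H as [a Ha Hi | c p q p' q' H H1 H2].
  - now apply same_place_mrk.
  - apply (same_place_step c p q); auto.
Qed.

(** A base marker lies in no foot, so p was reached by a step; the foot containing p identifies its
    letter. *)
Lemma paired_land (c : I * bool) (p q : R) :
  paired p q -> land D S c p ->
  exists p0 q0, paired p0 q0 /\ step D S c p0 p /\ step D S' c q0 q.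
Proof.
  intros H Hl. destruct H as [a Ha Hi | c' p q p' q' H H1 H2].
  - exfalso. apply (ini_mrk_not_land D S rz a c); auto.
  - assert (c = c') as ->.
    { apply (land_unique D S rz c c' p'); auto. apply (step_land D S rz c' p); auto. }
    eauto.
Qed.

(** Either p lies in the source of the letter, which is the destination of the inverse letter, and
    the letter undoes the last step of both histories; or it extends both. *)
Lemma paired_act (a : I) (k : bool) (p q p' q' : R) :
  paired p q -> isbump D a -> lft S a < p < rgt S a ->
  act S (a, k) p p' -> act S' (a, k) q q' -> paired p' q'.
Proof.
  intros H Ha Hs H1 H2. pose proof (paired_same_place p q H) as Hp.
  destruct (classic (land D S (a, negb k) p)) as [Hl|Hl].
  - destruct (paired_land _ _ _ H Hl) as (p0 & q0 & H0 & [Hd1 Hs1] & [Hd2 Hs2]).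
    apply act_negb in H1, H2.
    assert (p' = p0) as -> by (apply (act_back_fun D S rz (a, negb k) _ _ p); auto).
    assert (q' = q0) as -> by (apply (act_back_fun D S' rz' (a, negb k) _ _ q); auto).
    exact H0.
  - assert (Hd : dom D S (a, k) p).
    { simpl in *. split; auto. destruct k; simpl in Hl; split; try lra.
      - apply Rnot_lt_le. intros C. apply Hl. split; auto; lra.
      - apply Rnot_le_lt. intros C. apply Hl. split; auto; lra. }
    apply (paired_step (a, k) p q); auto; split; auto.
    now apply (same_place_dom _ p).
Qed.

End TwoSystems.

(** * Generators and their inverses, and words evaluated in two systems *)

Definition letter {D : diagram} (T : system) (w : J * bool) (x : R -> R) : Prop :=
  let (f, b) := w in
  islabel D f /\
  if b then x = gact T f
  else (forall t, x (gact T f t) = t) /\ (forall t, gact T f (x t) = t).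

Section Letters.

Variables (D : diagram) (S : system).
Hypothesis rz : realizes D S.

Lemma letter_incbij (w : J * bool) (x : R -> R) : letter (D := D) S w x -> incbij x.
Proof.
  destruct w as [f []]; simpl; intros [Hf H].
  - subst. now apply (rz_gact_inc D S rz).
  - destruct H as [H1 H2]. apply (incbij_of_inverse (gact S f)); auto.
    now apply (rz_gact_inc D S rz).
Qed.

(** [Bool.eqb k b] is the product of two signs: that of the bump in the generator f and the exponent
    b of the letter. *)
Lemma letter_act (f : J) (b : bool) (x : R -> R) (a : I) (k : bool) (p : R) :
  letter (D := D) S (f, b) x -> isbump D a -> incid D f a k ->
  lft S a < p < rgt S a -> act S (a, Bool.eqb k b) p (x p).
Proof.
  intros [Hf H] Ha He Hp.
  pose proof (rz_bmp_inc D S rz a Ha) as Hi.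
  destruct b.
  - subst x. destruct k; simpl.
    + now apply (rz_gact_pos D S rz).
    + now apply (rz_gact_neg D S rz f).
  - destruct H as [H1 H2]. destruct k; simpl.
    + destruct (proj2 Hi p) as [p0 Hp0].
      assert (Hs : lft S a < p0 < rgt S a).
      { apply (bmp_supt D S rz a p0 Ha). now rewrite Hp0. }
      rewrite <- (rz_gact_pos D S rz f a p0 Ha He Hs) in Hp0.
      rewrite <- Hp0 at 1. rewrite H1, <- (rz_gact_pos D S rz f a p0 Ha He Hs). auto.
    + assert (Hs : lft S a < bmp S a p < rgt S a) by now apply (bmp_supt D S rz a p Ha).
      pose proof (rz_gact_neg D S rz f a _ Ha He Hs) as E.
      apply (incbij_inj _ _ _ Hi) in E. rewrite <- E at 1. apply H1.
Qed.

Lemma letter_fix (f : J) (b : bool) (x : R -> R) (p : R) :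
  letter (D := D) S (f, b) x ->
  (forall a k, isbump D a -> incid D f a k -> ~ lft S a < p < rgt S a) -> x p = p.
Proof.
  intros [Hf H] Hp. pose proof (rz_gact_fix D S rz f p Hf Hp) as E.
  destruct b; [now subst|]. destruct H as [H1 H2]. rewrite <- E at 1. apply H1.
Qed.

Lemma letter_exists (f : J) (b : bool) : islabel D f -> exists x, letter (D := D) S (f, b) x.
Proof.
  intros Hf. destruct b; simpl.
  - eauto.
  - destruct (incbij_inverse _ (rz_gact_inc D S rz f Hf)) as (h & H1 & H2). eauto.
Qed.

Lemma letter_inverse (f : J) (b : bool) (x : R -> R) :
  letter (D := D) S (f, b) x ->
  exists y, letter (D := D) S (f, negb b) y /\ (forall t, y (x t) = t) /\ (forall t, x (y t) = t).
Proof.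
  intros [Hf H]. destruct b; simpl.
  - subst x. destruct (letter_exists f false Hf) as [y Hy].
    exists y. simpl in *. tauto.
  - exists (gact S f). tauto.
Qed.

End Letters.

Section TwoSystemsLetters.

Variables (D : diagram) (S S' : system).
Hypotheses (rz : realizes D S) (rz' : realizes D S') (cp : compatible D S S').

Lemma paired_letter (w : J * bool) (x x' : R -> R) (p q : R) :
  paired D S S' p q -> letter (D := D) S w x -> letter (D := D) S' w x' ->
  paired D S S' (x p) (x' q).
Proof.
  destruct w as [f b]. intros H Hx Hx'.
  pose proof (paired_same_place D S S' rz rz' cp p q H) as Hp.
  destruct (classic (exists a k, isbump D a /\ incid D f a k /\ lft S a < p < rgt S a))
    as [(a & k & Ha & He & Hs)|Hn].
  - pose proof (proj1 (same_place_supt D S S' a p q Hp Ha) Hs) as Hs'.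
    apply (paired_act D S S' rz rz' cp a (Bool.eqb k b) p q); auto.
    + apply (letter_act D S rz f); auto.
    + apply (letter_act D S' rz' f); auto.
  - rewrite (letter_fix D S rz f b x p Hx), (letter_fix D S' rz' f b x' q Hx'); auto.
    + intros a k Ha He Hs. apply Hn. exists a, k.
      rewrite (same_place_supt D S S' a p q Hp Ha). auto.
    + intros a k Ha He Hs. apply Hn. eauto.
Qed.

Lemma paired_sym (p q : R) : paired D S S' p q -> paired D S' S q p.
Proof.
  intros H. induction H as [a Ha Hi | c p q p' q' H IH H1 H2].
  - now apply paired_mrk.
  - apply (paired_step D S' S c q p); auto.
Qed.

(** Induction on the history of p. The order part makes the pairing monotone, and the equality part
    makes it a function. *)
Lemma paired_lt_eq (p q p' q' : R) :
  paired D S S' p q -> paired D S S' p' q' ->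
  (p < p' -> q < q') /\ (p = p' -> q = q').
Proof.
  intros H. revert p' q'. induction H as [a Ha Hi | c p q p1 q1 H IH H1 H2].
  - intros p' q' H'.
    pose proof (rz_chain D S rz a Ha) as Ca. pose proof (rz_chain D S' rz' a Ha) as Ca'.
    pose proof (same_place_mrk D S S' rz rz' cp a Ha Hi) as Hq.
    destruct H' as [b Hb Hib | c' p0 q0 p' q' H0 H1' H2'].
    + pose proof (rz_chain D S rz b Hb) as Cb. pose proof (rz_chain D S' rz' b Hb) as Cb'.
      destruct (Hq b Hb) as (_ & Hm & _). split; [tauto|].
      intros E. destruct (Rtotal_order (lft S a) (lft S b)) as [C|[C|C]].
      * pose proof (rz_src D S rz a b Ha Hb C). lra.
      * apply (rz_lft_inj D S rz) in C; auto. now subst.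
      * pose proof (rz_src D S rz b a Hb Ha C). lra.
    + pose proof (step_land D S rz _ _ _ H1') as L. pose proof (step_land D S' rz' _ _ _ H2') as L'.
      destruct c' as [b k]. pose proof (proj1 L) as Hb.
      destruct (Hq b Hb) as (A1 & A2 & A3 & A4).
      assert (NL := ini_mrk_not_land D S rz a (b, k) Ha Hi). simpl in NL, L, L'.
      (* The marker lies outside the foot of p', so the side on which it lies, the same in both
         systems, decides the order. *)
      split; [|intros E; exfalso; apply NL; rewrite E; auto].
      intros C. destruct k.
      * assert (X : mrk S a < img S b); [|apply A3 in X; lra].
        apply Rnot_le_lt. intros X. apply NL. split; auto; lra.
      * assert (X : mrk S a <= lft S b); [|apply A1 in X; lra].
        apply Rnot_lt_le. intros X. apply NL. split; auto; lra.
  - intros p' q' H'.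
    pose proof (step_land D S rz _ _ _ H1) as L. pose proof (step_land D S' rz' _ _ _ H2) as L'.
    pose proof (paired_same_place D S S' rz rz' cp p' q' H') as Hq.
    (* If both points lie in the same foot, the common last letter is undone and the induction
       hypothesis applies; otherwise their places decide. *)
    destruct (classic (land D S c p')) as [Hl|NL].
    + destruct (paired_land D S S' rz c p' q' H' Hl) as (p0 & q0 & H0 & [D0 A0] & [D0' A0']).
      destruct H1 as [D1 A1], H2 as [D2 A2].
      assert (Hb : isbump D (fst c)) by (apply (dom_bump D S c p D1)).
      destruct (IH p0 q0 H0) as [I1 I2]. split.
      * intros C. apply (act_lt D S' rz' c q q1 q0 q'); auto. apply I1.
        apply (act_lt D S rz c p p1 p0 p'); auto.
      * intros C. subst p'. assert (p = p0) as E.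
        { apply (act_back_fun D S rz c p p0 p1); auto. }
        apply I2 in E. subst q0. apply (act_fun D S' rz' c q); auto.
    + destruct c as [b k]. pose proof (proj1 L) as Hb.
      pose proof (rz_chain D S rz b Hb) as Cb. pose proof (rz_chain D S' rz' b Hb) as Cb'.
      destruct (Hq b Hb) as (A1 & A2 & A3 & A4). simpl in NL, L, L'.
      split; [|intros E; exfalso; apply NL; rewrite <- E; auto].
      intros C. destruct k.
      * assert (X : ~ p' < rgt S b); [|assert (~ q' < rgt S' b) by tauto; lra].
        intros X. apply NL. split; auto; lra.
      * assert (X : ~ p' < mrk S b); [|assert (~ q' < mrk S' b) by tauto; lra].
        intros X. apply NL. split; auto; lra.
Qed.

(** The history can be replayed in the other system, because whether a step is possible depends only
    on the place. *)
Lemma paired_lift (p0 p : R) : paired D S S p0 p -> exists q, paired D S S' p q.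
Proof.
  intros H. induction H as [a Ha Hi | c p0 p p0' p' H IH H1 H2].
  - exists (mrk S' a). now apply paired_mrk.
  - destruct IH as [q Hq].
    assert (Hd : dom D S' c q).
    { apply (same_place_dom D S S' c p q); [|apply H2].
      apply paired_same_place; auto. }
    destruct (step_exists D S' rz' c q Hd) as [q' Hq']. exists q'.
    apply (paired_step D S S' c p q); auto.
Qed.

(** The graph of the future isomorphism: both components are values of one word. A function may be
    the value of many words, so single-valuedness is a theorem, proved in [words_functional]. *)
Inductive words : (R -> R) -> (R -> R) -> Prop :=
  | words_id : words (fun t => t) (fun t => t)
  | words_mul : forall g g' w x x', words g g' ->
      letter (D := D) S w x -> letter (D := D) S' w x' -> words (mul g x) (mul g' x').

Lemma words_letter (w : J * bool) (x x' : R -> R) :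
  letter (D := D) S w x -> letter (D := D) S' w x' -> words x x'.
Proof.
  intros H H'. exact (words_mul _ _ w x x' words_id H H').
Qed.

Lemma words_compose (f f' g g' : R -> R) :
  words f f' -> words g g' -> words (mul f g) (mul f' g').
Proof.
  intros Hf Hg. induction Hg as [|g g' w x x' Hg IH Hx Hx'].
  - exact Hf.
  - exact (words_mul _ _ w x x' IH Hx Hx').
Qed.

Lemma words_inverse (f f' : R -> R) :
  words f f' -> exists h h', words h h' /\
    (forall t, h (f t) = t) /\ (forall t, f (h t) = t) /\
    (forall t, h' (f' t) = t) /\ (forall t, f' (h' t) = t).
Proof.
  intros Hf. induction Hf as [|f f' [j b] x x' Hf IH Hx Hx'].
  - exists (fun t => t), (fun t => t). repeat split; auto. apply words_id.
  - destruct IH as (h & h' & Hh & I1 & I2 & I3 & I4).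
    destruct (letter_inverse D S rz j b x Hx) as (y & Hy & Y1 & Y2).
    destruct (letter_inverse D S' rz' j b x' Hx') as (y' & Hy' & Y1' & Y2').
    exists (mul y h), (mul y' h'). split.
    + apply words_compose; auto. now apply (words_letter (j, negb b)).
    + unfold mul. repeat split; intros t; rewrite ?Y1, ?Y1', ?I2, ?I4; auto.
Qed.

Lemma words_incbij (f f' : R -> R) : words f f' -> incbij f.
Proof.
  intros Hf. induction Hf as [|f f' w x x' Hf IH Hx Hx'].
  - split; eauto.
  - apply incbij_mul; auto. apply (letter_incbij D S rz w); auto.
Qed.

Lemma paired_words (f f' : R -> R) (p q : R) :
  words f f' -> paired D S S' p q -> paired D S S' (f p) (f' q).
Proof.
  intros Hf H. induction Hf as [|f f' w x x' Hf IH Hx Hx']; auto.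
  unfold mul. now apply (paired_letter w).
Qed.

End TwoSystemsLetters.

Lemma words_sym (D : diagram) (S S' : system) (f f' : R -> R) :
  words D S S' f f' -> words D S' S f' f.
Proof.
  intros H. induction H as [|f f' w x x' Hf IH Hx Hx'].
  - apply words_id.
  - now apply (words_mul D S' S _ _ w).
Qed.

Lemma words_diag (D : diagram) (S S' : system) (f f' : R -> R) :
  words D S S' f f' -> words D S S f f.
Proof.
  intros H. induction H as [|f f' w x x' Hf IH Hx Hx'].
  - apply words_id.
  - now apply (words_mul D S S _ _ w).
Qed.

(** * Histories, and faithfulness of the action on paired points *)

Fixpoint push (D : diagram) (S : system) (U : list (I * bool)) (p p' : R) : Prop :=
  match U with
  | [] => p = p'
  | c :: U => exists p1, step D S c p p1 /\ push D S U p1 p'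
  end.

Section Faithful.

Variables (D : diagram) (S : system) (L : list I).
Hypotheses (rz : realizes D S) (Lfin : forall a, isbump D a -> In a L).

Let cp := compatible_refl D S.

Lemma step_fun (c : I * bool) (p p' p'' : R) :
  step D S c p p' -> step D S c p p'' -> p' = p''.
Proof.
  intros [Hd H1] [_ H2]. apply (act_fun D S rz c p); auto. now apply (dom_bump D S c p).
Qed.

Lemma step_back_fun (c : I * bool) (p p' p0 : R) :
  step D S c p p0 -> step D S c p' p0 -> p = p'.
Proof.
  intros [Hd H1] [_ H2]. apply (act_back_fun D S rz c p p' p0); auto.
  now apply (dom_bump D S c p).
Qed.

Lemma push_app (U V : list (I * bool)) (p p' : R) :
  push D S (U ++ V) p p' <-> exists p1, push D S U p p1 /\ push D S V p1 p'.
Proof.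
  revert p. induction U as [|c U IH]; intros p; simpl.
  - split; [eauto|]. intros (p1 & -> & H). exact H.
  - split.
    + intros (p1 & H1 & H2). apply IH in H2. destruct H2 as (p2 & H2 & H3). eauto.
    + intros (p2 & (p1 & H1 & H2) & H3). exists p1. split; auto. apply IH. eauto.
Qed.

Lemma push_snoc (U : list (I * bool)) (c : I * bool) (p p' : R) :
  push D S (U ++ [c]) p p' <-> exists p1, push D S U p p1 /\ step D S c p1 p'.
Proof.
  rewrite push_app. simpl. split; intros (p1 & H1 & H2); exists p1; split; auto.
  - destruct H2 as (p2 & H2 & <-). exact H2.
  - eauto.
Qed.

Lemma push_fun (U : list (I * bool)) (p p' p'' : R) :
  push D S U p p' -> push D S U p p'' -> p' = p''.
Proof.
  revert p. induction U as [|c U IH]; simpl; intros p; [congruence|].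
  intros (p1 & H1 & H2) (p2 & H3 & H4).
  rewrite (step_fun c p p2 p1) in H4; eauto.
Qed.

(** The foot containing p gives the last letter, which is then undone; the reading stops exactly at
    g, since g lies in no foot. *)
Lemma push_unique (U V : list (I * bool)) (g p : R) :
  (forall c, ~ land D S c g) -> push D S U g p -> push D S V g p -> U = V.
Proof.
  intros Hg. revert V p. induction U as [|c U IH] using rev_ind; intros V p.
  - simpl. intros <-. destruct V as [|c' V _] using rev_ind; auto.
    intros H. apply push_snoc in H. destruct H as (p1 & _ & H).
    exfalso. apply (Hg c'). now apply (step_land D S rz c' p1).
  - intros H. apply push_snoc in H. destruct H as (p1 & H1 & H2).
    destruct V as [|c' V _] using rev_ind.
    + simpl. intros <-. exfalso. apply (Hg c). now apply (step_land D S rz c p1).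
    + intros H. apply push_snoc in H. destruct H as (p2 & H3 & H4).
      assert (c = c') as <-.
      { apply (land_unique D S rz c c' p); eapply step_land; eauto. }
      assert (p1 = p2) as <- by (apply (step_back_fun c p1 p2 p); auto).
      f_equal. eapply IH; eauto.
Qed.

Lemma same_place_push (U : list (I * bool)) (p q p' : R) :
  same_place D S S p q -> push D S U p p' ->
  exists q', push D S U q q' /\ same_place D S S p' q'.
Proof.
  revert p q. induction U as [|c U IH]; simpl; intros p q H.
  - intros <-. eauto.
  - intros (p1 & [Hd Ha] & H2).
    destruct (step_exists D S rz c q (same_place_dom D S S c p q H Hd)) as [q1 Hq1].
    destruct (IH p1 q1) as (q' & Hq' & Hs); auto.
    + apply (same_place_step D S S rz rz cp c p q); auto. split; auto.
    + eauto.
Qed.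

Lemma letter_same_place (w : J * bool) (x : R -> R) (p : R) :
  letter (D := D) S w x ->
  (forall q, same_place D S S p q -> x q = q) \/
  exists a k, isbump D a /\ lft S a < p < rgt S a /\
    forall q, same_place D S S p q -> act S (a, k) q (x q).
Proof.
  destruct w as [f b]. intros Hx.
  destruct (classic (exists a k, isbump D a /\ incid D f a k /\ lft S a < p < rgt S a))
    as [(a & k & Ha & He & Hs)|Hn].
  - right. exists a, (Bool.eqb k b). split; auto. split; auto. intros q Hq.
    apply (letter_act D S rz f); auto. now apply (same_place_supt D S S a p q Hq Ha).
  - left. intros q Hq. apply (letter_fix D S rz f b x _ Hx).
    intros a k Ha He Hs. apply Hn. exists a, k.
    rewrite (same_place_supt D S S a p q Hq Ha). auto.
Qed.

Lemma same_place_refl (p : R) : same_place D S S p p.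
Proof. intros a _. tauto. Qed.

(* c is the point of the trajectory of t under h with the shortest history; the
   trajectory of any point of the form "q followed by U", with q placed like c,
   goes through the same bumps. *)
Lemma words_track (h h0 : R -> R) (t : R) :
  words D S S h h0 ->
  exists c U V, push D S U c t /\ push D S V c (h t) /\
    forall q q' q'', same_place D S S c q ->
      push D S U q q' -> push D S V q q'' -> h q' = q''.
Proof.
  intros H. induction H as [|h h0 w x x0 H IH Hx _].
  { exists t, [], []. simpl. repeat split; auto. congruence. }
  destruct IH as (c & U & V & HU & HV & Htr). unfold mul.
  assert (HVq : forall q q'', same_place D S S c q -> push D S V q q'' ->
                  same_place D S S (h t) q'').
  { intros q q'' Hq H2. destruct (same_place_push V c q (h t) Hq HV) as (q2 & Hq2 & Hs2).
    now rewrite (push_fun V q q'' q2 H2 Hq2). }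
  destruct (letter_same_place w x (h t) Hx) as [Hfix|(a & k & Ha & Hs & Hact)].
  { exists c, U, V. rewrite (Hfix (h t)) by apply same_place_refl.
    split; [auto|]. split; [auto|]. intros q q' q'' Hq H1 H2.
    rewrite (Htr q q' q'' Hq H1 H2). eauto. }
  pose proof (Hact _ (same_place_refl (h t))) as Hp.
  destruct (classic (land D S (a, negb k) (h t))) as [Hl|Hl].
  (* The letter acts off its source, hence prolongs the history V. *)
  2:{ assert (Hd : dom D S (a, k) (h t)).
      { simpl in *. split; auto. destruct k; simpl in Hl; split; try lra.
        - apply Rnot_lt_le. intros C. apply Hl. split; auto; lra.
        - apply Rnot_le_lt. intros C. apply Hl. split; auto; lra. }
      exists c, U, (V ++ [(a, k)]). split; auto. split.
      - apply push_snoc. exists (h t). split; auto. split; auto.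
      - intros q q' q'' Hq H1 H2. apply push_snoc in H2.
        destruct H2 as (q2 & H2 & H3). rewrite (Htr q q' q2 Hq H1 H2).
        apply (act_fun D S rz (a, k) q2); auto; [|apply H3].
        apply Hact. eauto. }
  destruct V as [|c' V _] using rev_ind.
  (* V is exhausted, so c itself is undone: the new root is [x (h t)], and U is preceded by the
     letter leading from it back to the old root. *)
  - simpl in HV. subst c.
    exists (x (h t)), ((a, negb k) :: U), [].
    assert (Hd : dom D S (a, negb k) (x (h t))).
    { pose proof (bmp_supt D S rz a (h t) Ha) as B1.
      pose proof (bmp_supt D S rz a (x (h t)) Ha) as B2.
      pose proof (rz_bmp_inc D S rz a Ha) as Hi. pose proof (rz_bmp_mrk D S rz a Ha) as Hm.
      simpl in *. split; auto. destruct k; simpl in *.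
      - rewrite Hp. split; [tauto|]. rewrite <- Hm. apply Hi. tauto.
      - split; [|rewrite <- Hp in Hs; tauto].
        apply Rnot_lt_le. intros C. apply Hi in C. rewrite Hp, Hm in C. lra. }
    assert (Hst : step D S (a, negb k) (x (h t)) (h t)).
    { split; auto. now apply act_negb in Hp. }
    split; [simpl; eauto|]. split; [reflexivity|].
    intros q q' q'' Hq (q0 & H0 & H1) H2. simpl in H2. subst q''.
    assert (Hq0 : same_place D S S (h t) q0).
    { apply (same_place_step D S S rz rz cp (a, negb k) (x (h t)) q); auto. }
    rewrite (Htr q0 q' q0 Hq0 H1 eq_refl).
    apply (act_fun D S rz (a, k) q0); auto. apply act_negb. apply H0.
  (* The last letter of the history is the inverse of the acting one, and the two cancel. *)
  - apply push_snoc in HV. destruct HV as (p1 & HV & H1).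
    assert (c' = (a, negb k)) as ->.
    { apply (land_unique D S rz _ _ (h t)); auto. now apply (step_land D S rz _ p1). }
    assert (x (h t) = p1) as ->.
    { apply (act_fun D S rz (a, k) (h t)); auto. apply act_negb. apply H1. }
    exists c, U, V. split; auto. split; auto.
    intros q q' q'' Hq HU' HV'.
    destruct (same_place_push V c q p1 Hq HV) as (q2 & Hq2 & Hs2).
    rewrite <- (push_fun V q q'' q2 HV' Hq2) in Hs2.
    destruct (step_exists D S rz (a, negb k) q'') as [q3 H3].
    { apply (same_place_dom D S S _ p1); auto. apply H1. }
    assert (Hq3 : push D S (V ++ [(a, negb k)]) q q3) by (apply push_snoc; eauto).
    rewrite (Htr q q' q3 Hq HU' Hq3).
    apply (act_fun D S rz (a, k) q3); auto; [|apply act_negb; apply H3].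
    apply Hact. eauto.
Qed.

Lemma paired_root (p q : R) :
  paired D S S p q -> exists W g, (forall c, ~ land D S c g) /\ push D S W g p.
Proof.
  intros H. induction H as [a Ha Hi|c p q p' q' H IH H1 H2].
  - exists [], (mrk S a). split; [|reflexivity].
    intros c. now apply (ini_mrk_not_land D S rz).
  - destruct IH as (W & g & Hg & HW). exists (W ++ [c]), g. split; auto.
    apply push_snoc. eauto.
Qed.

(** A counterexample with least left end is not initial; its marker is then the image of the marker
    of its predecessor, which begins further left. *)
Lemma paired_all_mrk (a : I) : isbump D a -> paired D S S (mrk S a) (mrk S a).
Proof.
  intros Ha. apply NNPP. intros Hn.
  destruct (list_min (lft S) (fun a => isbump D a /\ ~ paired D S S (mrk S a) (mrk S a)) L)
    as (b & _ & [Hb Nb] & Mb).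
  { exists a. auto. }
  destruct (classic (ini D b)) as [Hi|Hi].
  - apply Nb. now apply paired_mrk.
  - destruct (rz_prv_ex D S rz b Hb Hi) as (c & Hc & Hp).
    destruct (rz_prv D S rz b c Hb Hc Hp) as (H1 & H2 & H3).
    pose proof (rz_chain D S rz c Hc) as Cc.
    destruct (classic (paired D S S (mrk S c) (mrk S c))) as [Pc|Pc].
    + apply Nb. rewrite H3.
      assert (X : step D S (c, true) (mrk S c) (img S c)).
      { unfold step; simpl. rewrite (rz_bmp_mrk D S rz c Hc). repeat split; auto; lra. }
      apply (paired_step D S S (c, true) (mrk S c) (mrk S c)); auto.
    + specialize (Mb c (Lfin c Hc) (conj Hc Pc)). lra.
Qed.

(** The value q = p is allowed, so that paired points are included. *)
Definition lower_limit (p : R) : Prop :=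
  forall z, z < p -> exists q, paired D S S q q /\ z < q <= p.

Lemma paired_lower_limit (p : R) : paired D S S p p -> lower_limit p.
Proof. intros H z Hz. exists p. split; auto; lra. Qed.

Lemma lower_limit_fixed (h : R -> R) (p : R) :
  incbij h -> (forall q, paired D S S q q -> h q = q) -> lower_limit p -> h p = p.
Proof.
  intros Hi Hfix Hl. destruct (Rtotal_order (h p) p) as [C|[C|C]]; auto; exfalso.
  - destruct (Hl _ C) as (q & Hq & Hz). apply Hfix in Hq.
    destruct Hz as [H1 H2]. apply (incbij_le h) in H2; auto. lra.
  - destruct (proj2 Hi p) as [z Hz].
    assert (C' : z < p) by (apply (incbij_lt_inv h); auto; lra).
    destruct (Hl z C') as (q & Hq & H1 & H2). apply Hfix in Hq.
    apply Hi in H1. lra.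
Qed.

Lemma dom_supt (a : I) (k : bool) (p : R) : dom D S (a, k) p -> lft S a < p < rgt S a.
Proof.
  simpl. intros [Ha H]. pose proof (rz_chain D S rz a Ha). destruct k; lra.
Qed.

Lemma lower_limit_step (c : I * bool) (p p' : R) :
  step D S c p p' -> lower_limit p -> lower_limit p'.
Proof.
  destruct c as [a k]. intros [Hd Hp] Hl z Hz.
  pose proof (dom_supt a k p Hd) as Hs. pose proof (proj1 Hd) as Ha.
  destruct (act_exists D S rz (a, negb k) z Ha) as [z0 Hz0].
  apply act_negb in Hz0.
  assert (C : z0 < p) by (apply (act_lt D S rz (a, k) z0 z p p'); auto).
  (* Being above z0 puts the image of q above z; being above [lft] keeps q in the support of a,
     where the pairing is preserved. *)
  destruct (Hl (Rmax z0 (lft S a))) as (q & Hq & H1 & H2).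
  { apply Rmax_lub_lt; lra. }
  pose proof (Rmax_l z0 (lft S a)). pose proof (Rmax_r z0 (lft S a)).
  destruct (act_exists D S rz (a, k) q Ha) as [q' Hq'].
  exists q'. split; [|split].
  - apply (paired_act D S S rz rz cp a k q q); auto. lra.
  - apply (act_lt D S rz (a, k) z0 z q q'); auto. lra.
  - apply Rnot_lt_le. intros X. apply (act_lt D S rz (a, k) p p' q q') in X; auto. lra.
Qed.

Lemma lower_limit_push (U : list (I * bool)) (p p' : R) :
  push D S U p p' -> lower_limit p -> lower_limit p'.
Proof.
  revert p. induction U as [|c U IH]; simpl; intros p.
  - now intros <-.
  - intros (p1 & H1 & H2) H. apply (IH p1); auto. now apply (lower_limit_step c p).
Qed.

(* The supremum of the paired points of [mrk a, rgt a) is pushed up by a unless it is rgt a. *)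
Lemma lower_limit_rgt (a : I) : isbump D a -> lower_limit (rgt S a).
Proof.
  intros Ha. pose proof (rz_chain D S rz a Ha) as Ca.
  pose proof (rz_bmp_inc D S rz a Ha) as Hi.
  set (E := fun q => paired D S S q q /\ mrk S a <= q < rgt S a).
  destruct (completeness E) as [m [Hub Hlub]].
  { exists (rgt S a). intros q [_ Hq]. lra. }
  { exists (mrk S a). split; [now apply paired_all_mrk|lra]. }
  assert (Hm : m <= rgt S a) by (apply Hlub; intros q [_ Hq]; lra).
  assert (Hm0 : mrk S a <= m).
  { apply Hub. split; [now apply paired_all_mrk|lra]. }
  assert (Hnear : forall z, z < m -> exists q, E q /\ z < q).
  { intros z Hz. apply NNPP. intros Hn. assert (m <= z); [|lra].
    apply Hlub. intros q Hq. apply Rnot_lt_le. intros C. apply Hn. eauto. }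
  assert (Emr : m = rgt S a).
  { apply Rle_antisym; auto. apply Rnot_lt_le. intros C.
    destruct (proj2 Hi m) as [z Hz].
    assert (z < m).
    { apply (incbij_lt_inv _ _ _ Hi). rewrite Hz. apply (rz_bmp_pos D S rz); auto. lra. }
    destruct (Hnear z) as (q & [Hq Hqr] & Hzq); auto.
    assert (X : E (bmp S a q)).
    { assert (Hst : step D S (a, true) q (bmp S a q)) by (split; simpl; auto).
      split; [now apply (paired_step D S S (a, true) q q)|].
      apply (step_land D S rz) in Hst. simpl in Hst. lra. }
    apply Hub in X. apply Hi in Hzq. lra. }
  intros z Hz. rewrite <- Emr in Hz. destruct (Hnear z Hz) as (q & [Hq Hqr] & Hzq). exists q. split; auto; lra.
Qed.

(* In a gap between feet whose left neighbour is the source of a non-initial a, the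
   equality mrk a = img b of the canonical marking would leave no room. *)
Lemma gap_representative (c : R) (b : I) :
  (forall d, ~ land D S d c) -> isbump D b -> mrk S b <= c ->
  exists q, same_place D S S c q /\ lower_limit q /\ (forall d, ~ land D S d q).
Proof.
  intros Hc Hb Hbc.
  assert (Nsrc : forall a, isbump D a -> c < mrk S a -> c <= lft S a).
  { intros a Ha H. apply Rnot_lt_le. intros C. apply (Hc (a, false)). simpl. auto. }
  assert (Ndst : forall a, isbump D a -> img S a <= c -> rgt S a <= c).
  { intros a Ha H. apply Rnot_lt_le. intros C. apply (Hc (a, true)). simpl. auto. }
  (* a1 has the last source before c. The case split below asks whether some destination lies
     between that source and c. *)
  destruct (list_max (lft S) (fun a => isbump D a /\ mrk S a <= c) L)
    as (a1 & _ & [Ha1 H1] & M1); [eauto|].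
  pose proof (rz_chain D S rz a1 Ha1) as C1.
  assert (Hsrc : forall a, isbump D a -> lft S a1 < lft S a -> c <= lft S a).
  { intros a Ha H. apply Nsrc; auto. apply Rnot_le_lt. intros C.
    specialize (M1 a (Lfin a Ha) (conj Ha C)). lra. }
  destruct (classic (exists a, isbump D a /\ rgt S a <= c /\ lft S a1 < rgt S a))
    as [(a & Ha & Hac & Hla)|Hn].
  - destruct (list_max (rgt S) (fun a => isbump D a /\ rgt S a <= c) L)
      as (a2 & _ & [Ha2 H2] & M2); [eauto|].
    pose proof (M2 a (Lfin a Ha) (conj Ha Hac)) as Hl2.
    pose proof (rz_chain D S rz a2 Ha2) as C2.
    assert (Hdst : forall a, isbump D a -> img S a <= c -> rgt S a <= rgt S a2).
    { intros d Hd H. apply M2; auto. }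
    (* The right end of the last destination before c: it is outside this half-open foot, hence in
       the same gap as c. *)
    exists (rgt S a2). split; [|split].
    + intros d Hd. pose proof (rz_chain D S rz d Hd) as Cd.
      repeat split; try lra; intros H.
      * apply Hsrc; auto. lra.
      * apply Rnot_le_lt. intros X.
        assert (lft S d <= lft S a1) by (apply M1; auto).
        assert (Y : lft S d < rgt S a2) by lra.
        apply (rz_src_dst D S rz) in Y; auto. lra.
      * apply Rnot_le_lt. intros X. apply Hdst in X; auto. lra.
      * apply Rnot_le_lt. intros X. assert (Y : img S d <= c) by lra.
        apply Hdst in Y; auto. lra.
    + now apply lower_limit_rgt.
    + intros [d []]; simpl; intros [Hd H]; pose proof (rz_chain D S rz d Hd) as Cd.
      * assert (Y : img S d <= c) by lra. apply Hdst in Y; auto. lra.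
      * assert (Y : lft S d < rgt S a2) by lra.
        apply (rz_src_dst D S rz) in Y; auto. lra.
  - assert (Hdst : forall a, isbump D a -> img S a <= c -> rgt S a <= lft S a1).
    { intros d Hd H. apply Rnot_lt_le. intros X. apply Hn. eauto. }
    (* Otherwise the destination of the predecessor d would begin at [mrk a1], before c, and end
       after [lft a1], which the present case excludes. *)
    assert (Hini : ini D a1).
    { apply NNPP. intros Hi. destruct (rz_prv_ex D S rz a1 Ha1 Hi) as (d & Hd & Hp).
      destruct (rz_prv D S rz a1 d Ha1 Hd Hp) as (P1 & P2 & P3).
      assert (X : img S d <= c) by lra. apply Hdst in X; auto. lra. }
    exists (mrk S a1). split; [|split].
    + intros d Hd. pose proof (rz_chain D S rz d Hd) as Cd.
      repeat split; try lra; intros H.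
      * apply Hsrc; auto. lra.
      * destruct (Rtotal_order (lft S a1) (lft S d)) as [X|[X|X]].
        -- apply Hsrc in X; auto. lra.
        -- apply (rz_lft_inj D S rz) in X; auto. subst. lra.
        -- apply (rz_src D S rz) in X; auto. lra.
      * apply Rnot_le_lt. intros X. apply Hdst in X; auto. lra.
      * apply Rnot_le_lt. intros X. assert (Y : img S d <= c) by lra.
        apply Hdst in Y; auto. lra.
    + apply paired_lower_limit. now apply paired_mrk.
    + intros d. now apply (ini_mrk_not_land D S rz).
Qed.

(** The marker of a is off the sources of both letters of a, so each letter carries it, paired by
    [paired_all_mrk], into its destination. *)
Lemma foot_representative (c : R) (d : I * bool) :
  land D S d c -> exists q, same_place D S S c q /\ paired D S S q q.
Proof.
  intros Hl. destruct d as [a k]. pose proof (proj1 Hl) as Ha.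
  pose proof (rz_chain D S rz a Ha) as Ca.
  assert (Hd : dom D S (a, k) (mrk S a)).
  { simpl. split; auto. destruct k; lra. }
  destruct (step_exists D S rz _ _ Hd) as [q Hq].
  exists q. split.
  - apply (same_place_land D S S rz rz cp (a, k)); auto. now apply (step_land D S rz _ (mrk S a)).
  - apply (paired_step D S S (a, k) (mrk S a) (mrk S a)); auto. now apply paired_all_mrk.
Qed.

(** Supplies the source before c that [gap_representative] requires: c is in the support of the
    first letter but in no foot. *)
Lemma push_dom_mrk (U : list (I * bool)) (c t : R) :
  (forall d, ~ land D S d c) -> push D S U c t -> U <> [] ->
  exists b, isbump D b /\ mrk S b <= c.
Proof.
  intros Hc HU Hne. destruct U as [|[b k] U]; [congruence|].
  destruct HU as (p1 & [Hd _] & _). exists b. split; [apply Hd|].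
  pose proof (dom_supt b k c Hd). apply Rnot_lt_le. intros C.
  apply (Hc (b, false)). simpl. split; [apply Hd|lra].
Qed.

Lemma words_faithful (h h0 : R -> R) :
  words D S S h h0 -> (forall q, paired D S S q q -> h q = q) -> forall t, h t = t.
Proof.
  intros Hw Hfix t. apply NNPP. intros Hne.
  destruct (words_track h h0 t Hw) as (c & U & V & HU & HV & Htr).
  assert (HUV : U <> V).
  { intros ->. apply Hne. now apply (push_fun V c). }
  (* The root c is replaced by a point q that h controls through its fixed points and that has a
     history W from a point g outside all feet. *)
  assert (Hrep : exists q, same_place D S S c q /\ lower_limit q /\
             exists W g, (forall d, ~ land D S d g) /\ push D S W g q).
  { destruct (classic (exists d, land D S d c)) as [[d Hd]|Hn].
    - destruct (foot_representative c d Hd) as (q & Hq & Hp).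
      exists q. split; auto. split; [now apply paired_lower_limit|].
      now apply (paired_root q q).
    - assert (Hc : forall d, ~ land D S d c) by (intros d Hd; eauto).
      assert (Hb : exists b, isbump D b /\ mrk S b <= c).
      { destruct U as [|u U]; [|apply (push_dom_mrk (u :: U) c t); auto; congruence].
        apply (push_dom_mrk V c (h t)); auto. }
      destruct Hb as (b & Hb & Hbc).
      destruct (gap_representative c b Hc Hb Hbc) as (q & Hq & Hl & Hg).
      exists q. split; auto. split; auto. exists [], q. split; auto. reflexivity. }
  destruct Hrep as (q & Hq & Hl & W & g & Hg & HW).
  destruct (same_place_push U c q _ Hq HU) as (q' & Hq' & _).
  destruct (same_place_push V c q _ Hq HV) as (q'' & Hq'' & _).
  (* h sends q' to q'', but q' is again a limit from below of paired points and is therefore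
     fixed. *)
  assert (E : q' = q'').
  { rewrite <- (Htr q q' q'' Hq Hq' Hq''). symmetry.
    apply lower_limit_fixed; auto.
    - apply (words_incbij D S S rz h h0 Hw).
    - now apply (lower_limit_push U q). }
  (* W followed by U and W followed by V are now histories of one point from g, hence equal. *)
  subst q''. apply HUV. apply (app_inv_head W).
  apply (push_unique (W ++ U) (W ++ V) g q'); auto; apply push_app; eauto.
Qed.

End Faithful.

Section Uniqueness.

Variables (D : diagram) (S S' : system) (L : list I).
Hypotheses (rz : realizes D S) (rz' : realizes D S') (cp : compatible D S S').
Hypothesis Lfin : forall a, isbump D a -> In a L.

(** The inverse of f1 followed by f2 fixes every paired point of the second system: there f1 and f2
    both send the partner of p to the partner of [f p]. Faithfulness then makes the product the
    identity. *)
Lemma words_functional (f f1 f2 : R -> R) :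
  words D S S' f f1 -> words D S S' f f2 -> f1 = f2.
Proof.
  intros H1 H2.
  pose proof (words_diag D S' S f1 f (words_sym D S S' f f1 H1)) as W1.
  pose proof (words_diag D S' S f2 f (words_sym D S S' f f2 H2)) as W2.
  destruct (words_inverse D S' S' rz' rz' f1 f1 W1) as (h & h' & Hh & I1 & I2 & _ & _).
  assert (X : forall t, mul h f2 t = t).
  { apply (words_faithful D S' L rz' Lfin (mul h f2) (mul h' f2)).
    - now apply words_compose.
    - intros q Hq. unfold mul.
      assert (Hhq : paired D S' S' (h q) (h' q)).
      { apply paired_words; auto. apply compatible_refl. }
      destruct (paired_lift D S' S rz' rz (compatible_sym D S S' cp) (h' q) (h q)) as [p Hp].
      { apply (paired_sym D S' S'). exact Hhq. }
      apply paired_sym in Hp.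
      pose proof (paired_words D S S' rz rz' cp f f1 p (h q) H1 Hp) as P1.
      pose proof (paired_words D S S' rz rz' cp f f2 p (h q) H2 Hp) as P2.
      rewrite <- (I2 q) at 2.
      symmetry. now apply (paired_lt_eq D S S' rz rz' cp _ _ _ _ P1 P2). }
  apply functional_extensionality. intros t.
  rewrite <- (X (f1 t)). unfold mul. now rewrite I1.
Qed.

End Uniqueness.

End PingPong.

(** * Homeomorphisms of the interval and their bumps *)

Lemma homeo_plus_incbij (f : R -> R) : homeo_plus f -> incbij f.
Proof.
  intros (Hout & Hin & Hinc & Hsurj & _). split.
  - intros s t C. destruct (classic (inI s)) as [Hs|Hs], (classic (inI t)) as [Ht|Ht].
    + auto.
    + rewrite (Hout t Ht). specialize (Hin s Hs). unfold inI in *. lra.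
    + rewrite (Hout s Hs). specialize (Hin t Ht). unfold inI in *. lra.
    + now rewrite !Hout.
  - intros u. destruct (classic (inI u)) as [Hu|Hu].
    + destruct (Hsurj u Hu) as (t & _ & Ht). eauto.
    + eauto.
Qed.

Lemma incbij_homeo_plus (f : R -> R) :
  incbij f -> (forall t, ~ inI t -> f t = t) -> homeo_plus f.
Proof.
  intros Hf Hout. split; [auto|]. split; [|split; [|split]].
  - intros t Ht. apply NNPP. intros Hn. apply Hn.
    rewrite (incbij_inj f (f t) t Hf (Hout _ Hn)). exact Ht.
  - intros s t _ _. apply Hf.
  - intros u Hu. destruct (proj2 Hf u) as [t Ht]. exists t. split; auto.
    apply NNPP. intros Hn. rewrite (Hout t Hn) in Ht. now subst.
  - intros t _ eps Heps.
    (* Continuity comes from surjectivity: the preimages of [f t - eps] and [f t + eps] bound a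
       neighbourhood of t. *)
    destruct (proj2 Hf (f t - eps)) as [a Ha]. destruct (proj2 Hf (f t + eps)) as [b Hb].
    assert (a < t) by (apply (incbij_lt_inv f); auto; lra).
    assert (t < b) by (apply (incbij_lt_inv f); auto; lra).
    exists (Rmin (t - a) (b - t)). split; [apply Rmin_glb_lt; lra|].
    intros s _ Hs. pose proof (Rmin_l (t - a) (b - t)). pose proof (Rmin_r (t - a) (b - t)).
    apply Rabs_def2 in Hs. apply Rabs_def1.
    + assert (X : f s < f b) by (apply Hf; lra). lra.
    + assert (X : f a < f s) by (apply Hf; lra). lra.
Qed.

Lemma sup_near (E : R -> Prop) (m z : R) :
  is_lub E m -> z < m -> exists q, E q /\ z < q.
Proof.
  intros [_ Hlub] Hz. apply NNPP. intros Hn. assert (m <= z); [|lra].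
  apply Hlub. intros q Hq. apply Rnot_lt_le. intros C. apply Hn. eauto.
Qed.

(** x is the supremum of the fixed points up to p; if it moved, fixed points near it would
    contradict monotonicity of f. *)
Lemma last_fixed_below (f : R -> R) (lo p : R) :
  incbij f -> lo <= p -> f lo = lo -> f p <> p ->
  exists x, lo <= x < p /\ f x = x /\ forall t, x < t <= p -> f t <> t.
Proof.
  intros Hf Hlo Elo Hp.
  destruct (completeness (fun s => s <= p /\ f s = s)) as [x Hx].
  { exists p. intros s [Hs _]. auto. }
  { exists lo. auto. }
  pose proof Hx as [Hub Hlub].
  assert (H1 : lo <= x) by (apply Hub; auto).
  assert (H2 : x <= p) by (apply Hlub; intros s [Hs _]; auto).
  assert (E : f x = x).
  { destruct (Rtotal_order (f x) x) as [C|[C|C]]; auto; exfalso.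
    - destruct (sup_near _ _ _ Hx C) as (s & [Hs Es] & Hfs).
      assert (Y : s <= x) by (apply Hub; auto).
      apply (incbij_le f _ _ Hf) in Y. lra.
    - destruct (proj2 Hf x) as [z Hz].
      assert (Cz : z < x) by (apply (incbij_lt_inv f); auto; lra).
      destruct (sup_near _ _ _ Hx Cz) as (s & [Hs Es] & Hzs).
      assert (Y : s <= x) by (apply Hub; auto). apply Hf in Hzs. lra. }
  exists x. split; [|split; auto].
  - split; auto. destruct H2 as [H2|H2]; auto. subst. contradiction.
  - intros t Ht Et. assert (Y : t <= x) by (apply Hub; split; [lra|auto]). lra.
Qed.

Lemma first_fixed_above (f : R -> R) (hi p : R) :
  incbij f -> p <= hi -> f hi = hi -> f p <> p ->
  exists y, p < y <= hi /\ f y = y /\ forall t, p <= t < y -> f t <> t.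
Proof.
  intros Hf Hhi Ehi Hp.
  (* Reflection in 0 exchanges the two directions. *)
  destruct (last_fixed_below (fun t => - f (- t)) (- hi) (- p)) as (x & Hx & Ex & Nx).
  - split.
    + intros s t C. assert (X : f (- t) < f (- s)) by (apply Hf; lra). lra.
    + intros u. destruct (proj2 Hf (- u)) as [t Ht]. exists (- t).
      rewrite Ropp_involutive. lra.
  - lra.
  - rewrite Ropp_involutive. lra.
  - rewrite Ropp_involutive. lra.
  - exists (- x). split; [lra|]. split; [lra|].
    intros t Ht Et. apply (Nx (- t)); [lra|]. rewrite Ropp_involutive. lra.
Qed.

Lemma homeo_plus_0 (f : R -> R) : homeo_plus f -> f 0 = 0.
Proof.
  intros (_ & Hin & Hinc & Hsurj & _).
  assert (H0 : inI 0) by (unfold inI; lra).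
  destruct (Hsurj 0 H0) as (t & Ht & Et).
  destruct (Req_dec t 0) as [->|Hne]; auto.
  assert (C : f 0 < f t) by (apply Hinc; auto; unfold inI in Ht; lra).
  specialize (Hin 0 H0). unfold inI in Hin. lra.
Qed.

Lemma homeo_plus_1 (f : R -> R) : homeo_plus f -> f 1 = 1.
Proof.
  intros (_ & Hin & Hinc & Hsurj & _).
  assert (H0 : inI 1) by (unfold inI; lra).
  destruct (Hsurj 1 H0) as (t & Ht & Et).
  destruct (Req_dec t 1) as [->|Hne]; auto.
  assert (C : f t < f 1) by (apply Hinc; auto; unfold inI in Ht; lra).
  specialize (Hin 1 H0). unfold inI in Hin. lra.
Qed.

Lemma supt_orbital (f : R -> R) (p : R) :
  homeo_plus f -> supt f p -> exists x y, orbital f x y /\ x < p < y.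
Proof.
  intros Hf [Hp Np]. pose proof (homeo_plus_incbij f Hf) as Hi. unfold inI in Hp.
  destruct (last_fixed_below f 0 p) as (x & Hx & Ex & Nx); auto; [lra|now apply homeo_plus_0|].
  destruct (first_fixed_above f 1 p) as (y & Hy & Ey & Ny); auto; [lra|now apply homeo_plus_1|].
  exists x, y. split; [|lra]. repeat split; auto; try lra.
  intros t Ht. destruct (Rle_lt_dec t p); [apply Nx|apply Ny]; lra.
Qed.

Lemma fixed_between (f : R -> R) (s t : R) :
  incbij f -> s < t -> s < f s -> f t < t -> exists m, s < m < t /\ f m = m.
Proof.
  intros Hf C Hs Ht.
  destruct (completeness (fun u => s <= u <= t /\ u < f u)) as [m Hm].
  { exists t. intros u [Hu _]. lra. }
  { exists s. split; [lra|auto]. }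
  pose proof Hm as [Hub Hlub].
  assert (H1 : s <= m) by (apply Hub; split; [lra|auto]).
  assert (H2 : m <= t) by (apply Hlub; intros u [Hu _]; lra).
  assert (E : f m = m).
  { destruct (Rtotal_order (f m) m) as [X|[X|X]]; auto; exfalso.
    - destruct (sup_near _ _ _ Hm X) as (u & [Hu Hfu] & Hmu).
      assert (Y : u <= m) by (apply Hub; auto). apply (incbij_le f _ _ Hf) in Y. lra.
    - destruct H2 as [H2|H2]; [|subst; lra].
      (* u lies above m but below [f m], so u < f m < f u: it is moved up, against the choice of
         m. *)
      set (u := (m + Rmin (f m) t) / 2).
      pose proof (Rmin_l (f m) t). pose proof (Rmin_r (f m) t).
      assert (m < Rmin (f m) t) by (apply Rmin_glb_lt; auto).
      assert (Y : f m < f u) by (apply Hf; unfold u; lra).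
      assert (Z : u <= m) by (apply Hub; unfold u in *; split; lra).
      unfold u in Z. lra. }
  exists m. split; auto. split.
  - destruct H1 as [H1|H1]; auto. subst. lra.
  - destruct H2 as [H2|H2]; auto. subst. lra.
Qed.

Lemma orbital_sign (f : R -> R) (x y : R) :
  incbij f -> orbital f x y ->
  (forall t, x < t < y -> t < f t) \/ (forall t, x < t < y -> f t < t).
Proof.
  intros Hf (H0 & Hxy & H1 & Ex & Ey & N).
  apply NNPP. intros Hn. apply not_or_and in Hn. destruct Hn as [Hn1 Hn2].
  apply not_all_ex_not in Hn1. destruct Hn1 as [t Ht].
  apply not_all_ex_not in Hn2. destruct Hn2 as [s Hs].
  apply imply_to_and in Ht. destruct Ht as [It Ht].
  apply imply_to_and in Hs. destruct Hs as [Is Hs].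
  pose proof (N t It) as Nt. pose proof (N s Is) as Ns.
  assert (Ft : f t < t) by lra. assert (Fs : s < f s) by lra.
  destruct (Rtotal_order s t) as [C|[C|C]].
  - destruct (fixed_between f s t) as (m & Hm & Em); auto. apply (N m); auto. lra.
  - subst. lra.
  (* The point moved up is on the right here; the inverse of f exchanges up and down and has the
     same fixed points. *)
  - destruct (incbij_inverse f Hf) as (h & H2 & H3).
    pose proof (incbij_of_inverse f h Hf H2 H3) as Hh.
    destruct (fixed_between h t s) as (m & Hm & Em); auto.
    + apply (incbij_lt_inv f); auto. now rewrite H3.
    + apply (incbij_lt_inv f); auto. now rewrite H3.
    + apply (N m); [lra|]. rewrite <- Em at 1. apply H3.
Qed.

(** * Cutting bumps out of a homeomorphism *)

Definition restrict (f : R -> R) (x y t : R) : R :=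
  if Rlt_dec x t then if Rlt_dec t y then f t else t else t.

Lemma restrict_in (f : R -> R) (x y t : R) : x < t < y -> restrict f x y t = f t.
Proof.
  intros [H1 H2]. unfold restrict. destruct (Rlt_dec x t), (Rlt_dec t y); tauto.
Qed.

Lemma restrict_out (f : R -> R) (x y t : R) : ~ x < t < y -> restrict f x y t = t.
Proof.
  intros H. unfold restrict. destruct (Rlt_dec x t), (Rlt_dec t y); tauto.
Qed.

Lemma incbij_maps_interval (f : R -> R) (x y t : R) :
  incbij f -> f x = x -> f y = y -> (x < t < y <-> x < f t < y).
Proof.
  intros Hf Ex Ey. rewrite <- Ex at 2. rewrite <- Ey at 2.
  split; intros [H1 H2]; split; try (now apply Hf); now apply (incbij_lt_inv f).
Qed.

Lemma incbij_restrict (f : R -> R) (x y : R) :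
  incbij f -> f x = x -> f y = y -> incbij (restrict f x y).
Proof.
  intros Hf Ex Ey. pose proof (fun t => incbij_maps_interval f x y t Hf Ex Ey) as Hm. split.
  - intros s t C.
    destruct (classic (x < s < y)) as [Hs|Hs], (classic (x < t < y)) as [Ht|Ht];
      rewrite ?(restrict_in f x y s Hs), ?(restrict_in f x y t Ht),
        ?(restrict_out f x y s Hs), ?(restrict_out f x y t Ht); auto.
    + now apply Hf.
    + pose proof (proj1 (Hm s) Hs). lra.
    + pose proof (proj1 (Hm t) Ht). lra.
  - intros u. destruct (classic (x < u < y)) as [Hu|Hu].
    + destruct (proj2 Hf u) as [t Ht]. exists t. rewrite <- Ht in Hu.
      apply Hm in Hu. now rewrite restrict_in.
    + exists u. now apply restrict_out.
Qed.

Lemma pos_bump_restrict (f : R -> R) (x y : R) :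
  incbij f -> 0 <= x -> x < y -> y <= 1 -> f x = x -> f y = y ->
  (forall t, x < t < y -> t < f t) -> pos_bump (restrict f x y).
Proof.
  intros Hf H0 Hxy H1 Ex Ey Hpos.
  assert (Hfix : forall t, restrict f x y t = t <-> ~ x < t < y).
  { intros t. split; [|apply restrict_out].
    intros E C. rewrite restrict_in in E by auto. specialize (Hpos t C). lra. }
  split; [split|].
  - apply incbij_homeo_plus; [now apply incbij_restrict|].
    intros t Ht. apply restrict_out. unfold inI in Ht. lra.
  - exists x, y. split.
    + repeat split; auto; try (apply Hfix; lra).
      intros t Ht E. apply Hfix in E. auto.
    + intros x' y' (A0 & Axy & A1 & Ax & Ay & AN).
      apply Hfix in Ax, Ay.
      assert (AN' : forall t, x' < t < y' -> x < t < y).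
      { intros t Ht. apply NNPP. intros X. apply (AN t Ht). now apply Hfix. }
      pose proof (AN' ((x' + y') / 2)) as M.
      assert (x' = x).
      { destruct (Rtotal_order x' x) as [C|[C|C]]; auto; [|lra].
        pose proof (AN' ((x' + Rmin x y') / 2)) as X.
        pose proof (Rmin_l x y'). pose proof (Rmin_r x y').
        assert (x' < Rmin x y') by (apply Rmin_glb_lt; auto). lra. }
      split; auto. subst x'.
      destruct (Rtotal_order y' y) as [C|[C|C]]; auto; [lra|].
      specialize (AN' y). lra.
  - intros t [_ Ht].
    assert (X : x < t < y).
    { apply NNPP. intros X. apply Ht. now apply Hfix. }
    rewrite restrict_in; auto.
Qed.

Definition carries (f a : R -> R) (k : bool) : Prop :=
  if k then agrees f a else agrees_inv f a.

Lemma supt_carries (f : R -> R) (p : R) :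
  homeo_plus f -> supt f p ->
  exists a k, pos_bump a /\ carries f a k /\ supt a p.
Proof.
  intros Hf Hp. pose proof (homeo_plus_incbij f Hf) as Hi.
  destruct (supt_orbital f p Hf Hp) as (x & y & Ho & Hxp).
  pose proof Ho as (H0 & Hxy & H1 & Ex & Ey & N).
  assert (Hsupt : forall g t, supt (restrict g x y) t -> x < t < y).
  { intros g t [_ Ht]. apply NNPP. intros X. apply Ht. now apply restrict_out. }
  destruct (orbital_sign f x y Hi Ho) as [Hs|Hs].
  - exists (restrict f x y), true. split; [now apply pos_bump_restrict|]. split.
    + intros t Ht. apply Hsupt in Ht. now rewrite restrict_in.
    + split; [apply Hp|]. rewrite restrict_in; auto.
  (* On an orbital where f moves points down, the positive bump is a restriction of the inverse. *)
  - destruct (incbij_inverse f Hi) as (h & H2 & H3).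
    pose proof (incbij_of_inverse f h Hi H2 H3) as Hh.
    assert (Hpos : forall t, x < t < y -> t < h t).
    { intros t Ht. apply (incbij_lt_inv f); auto. rewrite H3; auto. }
    exists (restrict h x y), false. split; [|split].
    + apply pos_bump_restrict; auto.
      * rewrite <- Ex at 1. apply H2.
      * rewrite <- Ey at 1. apply H2.
    + intros t Ht. apply Hsupt in Ht. rewrite restrict_in; auto.
      now apply (incbij_maps_interval f x y t).
    + split; [apply Hp|]. rewrite restrict_in; auto. specialize (Hpos p Hxp). lra.
Qed.

(** For a bump the orbital is unique, so the choice is forced; for a function without orbital the
    value is arbitrary. *)
Definition lend (a : R -> R) : R := epsilon (inhabits 0) (fun x => exists y, orbital a x y).
Definition rend (a : R -> R) : R := epsilon (inhabits 0) (fun y => orbital a (lend a) y).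

Lemma bump_orbital (a : R -> R) : bump a -> orbital a (lend a) (rend a).
Proof.
  intros [_ (x & y & Ho & _)].
  apply (epsilon_spec (inhabits 0) (fun y => orbital a (lend a) y)).
  apply (epsilon_spec (inhabits 0) (fun x => exists y, orbital a x y)). eauto.
Qed.

Lemma bump_orbital_eq (a : R -> R) (x y : R) :
  bump a -> orbital a x y -> x = lend a /\ y = rend a.
Proof.
  intros Ha Ho. pose proof (bump_orbital a Ha) as Ho'.
  destruct Ha as [_ (x0 & y0 & _ & H)].
  destruct (H _ _ Ho), (H _ _ Ho'). subst. split; congruence.
Qed.

Lemma bump_supt (a : R -> R) (t : R) : bump a -> (supt a t <-> lend a < t < rend a).
Proof.
  intros Ha. pose proof (bump_orbital a Ha) as (H0 & Hxy & H1 & Ex & Ey & N). split.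
  - intros Ht. destruct (supt_orbital a t (proj1 Ha) Ht) as (x & y & Ho & Hxt).
    apply bump_orbital_eq in Ho; auto. destruct Ho; subst. auto.
  - intros Ht. split; auto. unfold inI. lra.
Qed.

Lemma bump_left_tp (a : R -> R) (t : R) : bump a -> (left_tp a t <-> t = lend a).
Proof.
  intros Ha. pose proof (bump_orbital a Ha) as (H0 & Hxy & H1 & _).
  unfold left_tp. rewrite bump_supt by auto. split.
  - intros (Ht & Hn & He).
    destruct (Rtotal_order t (lend a)) as [C|[C|C]]; auto; exfalso.
    + destruct (He (lend a - t)) as (s & Hs & X); [lra|]. apply bump_supt in X; auto. lra.
    + destruct (He 1) as (s & Hs & X); [lra|]. apply bump_supt in X; auto. lra.
  - intros ->. split; [unfold inI; lra|]. split; [lra|].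
    intros eps Heps. exists (lend a + Rmin eps (rend a - lend a) / 2).
    pose proof (Rmin_l eps (rend a - lend a)). pose proof (Rmin_r eps (rend a - lend a)).
    assert (0 < Rmin eps (rend a - lend a)) by (apply Rmin_glb_lt; lra).
    rewrite bump_supt by auto. lra.
Qed.

Lemma bump_right_tp (a : R -> R) (t : R) : bump a -> (right_tp a t <-> t = rend a).
Proof.
  intros Ha. pose proof (bump_orbital a Ha) as (H0 & Hxy & H1 & _).
  unfold right_tp. rewrite bump_supt by auto. split.
  - intros (Ht & Hn & He).
    destruct (Rtotal_order t (rend a)) as [C|[C|C]]; auto; exfalso.
    + destruct (He 1) as (s & Hs & X); [lra|]. apply bump_supt in X; auto. lra.
    + destruct (He (t - rend a)) as (s & Hs & X); [lra|]. apply bump_supt in X; auto. lra.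
  - intros ->. split; [unfold inI; lra|]. split; [lra|].
    intros eps Heps. exists (rend a - Rmin eps (rend a - lend a) / 2).
    pose proof (Rmin_l eps (rend a - lend a)). pose proof (Rmin_r eps (rend a - lend a)).
    assert (0 < Rmin eps (rend a - lend a)) by (apply Rmin_glb_lt; lra).
    rewrite bump_supt by auto. lra.
Qed.

Lemma carries_maps (f a : R -> R) (k : bool) (t : R) :
  pos_bump a -> carries f a k -> lend a < t < rend a ->
  lend a < f t < rend a /\ exists s, lend a < s < rend a /\ f s = t.
Proof.
  intros [Ha _] Hc Ht. pose proof (homeo_plus_incbij a (proj1 Ha)) as Hi.
  pose proof (bump_orbital a Ha) as (_ & _ & _ & Ex & Ey & _).
  pose proof (fun u => incbij_maps_interval a _ _ u Hi Ex Ey) as Hm.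
  destruct k; simpl in Hc.
  - split.
    + rewrite Hc by (apply bump_supt; auto). now apply (proj1 (Hm t)).
    + destruct (proj2 Hi t) as [s Hs]. exists s.
      assert (lend a < s < rend a) by (apply (proj2 (Hm s)); now rewrite Hs).
      split; auto. rewrite Hc; auto. now apply bump_supt.
  - split.
    + apply (proj2 (Hm (f t))). rewrite Hc; auto. now apply bump_supt.
    + exists (a t). assert (X : lend a < a t < rend a) by now apply (proj1 (Hm t)).
      split; auto. apply (incbij_inj a); auto. apply Hc. now apply bump_supt.
Qed.

Lemma carries_left_tp (f a : R -> R) (k : bool) :
  homeo_plus f -> pos_bump a -> carries f a k -> left_tp f (lend a).
Proof.
  intros Hf Ha Hc. pose proof (homeo_plus_incbij f Hf) as Hi.
  pose proof (bump_orbital a (proj1 Ha)) as (H0 & Hxy & H1 & _ & _ & N).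
  pose proof (fun t => carries_maps f a k t Ha Hc) as Hm.
  (* f maps the orbital of a onto itself. Moving the left end down would push points out of the
     orbital; moving it up would leave points of the orbital uncovered. *)
  assert (E : f (lend a) = lend a).
  { destruct (Rtotal_order (f (lend a)) (lend a)) as [C|[C|C]]; auto; exfalso.
    - destruct (proj2 Hi (lend a)) as [z Hz].
      assert (Cz : lend a < z) by (apply (incbij_lt_inv f); auto; lra).
      pose proof (Rmin_l z (rend a)). pose proof (Rmin_r z (rend a)).
      assert (lend a < Rmin z (rend a)) by (apply Rmin_glb_lt; auto).
      destruct (Hm ((lend a + Rmin z (rend a)) / 2)) as [X _]; [lra|].
      assert (Y : f ((lend a + Rmin z (rend a)) / 2) < f z) by (apply Hi; lra). lra.
    - pose proof (Rmin_l (f (lend a)) (rend a)). pose proof (Rmin_r (f (lend a)) (rend a)).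
      assert (lend a < Rmin (f (lend a)) (rend a)) by (apply Rmin_glb_lt; auto).
      destruct (Hm ((lend a + Rmin (f (lend a)) (rend a)) / 2)) as [_ (s & Hs & Es)]; [lra|].
      assert (Y : f (lend a) < f s) by (apply Hi; lra). lra. }
  assert (Hl : left_tp a (lend a)) by (now apply bump_left_tp; [apply Ha|]).
  destruct Hl as (L1 & L2 & L3). split; auto. split; [intros [_ X]; auto|].
  intros eps Heps. destruct (L3 eps Heps) as (s & Hs & Hsa). exists s. split; auto.
  pose proof Hsa as [Is Ns]. split; auto. intros Es. apply Ns.
  destruct k; simpl in Hc.
  - rewrite <- (Hc s Hsa). exact Es.
  - rewrite <- Es at 1. now apply Hc.
Qed.

(** * The canonical marking *)

(** [initial] expressed by comparisons of ends only, so that it is visible in the diagram; isolated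
    bumps satisfy it vacuously. *)
Definition ini_bump (A : (R -> R) -> Prop) (a : R -> R) : Prop :=
  forall c, A c -> lend a < rend c < rend a -> exists b, A b /\ lend a < lend b < rend c.

(* The least transition point in the support of a is the right end of b. *)
Definition prv_bump (A : (R -> R) -> Prop) (a b : R -> R) : Prop :=
  lend a < rend b < rend a /\
  (forall c, A c -> lend a < lend c -> rend b <= lend c) /\
  (forall c, A c -> lend a < rend c -> rend b <= rend c).

(** The recursion along increasing left ends, written as a relation without an enumeration of A. *)
Inductive canonical (A : (R -> R) -> Prop) : (R -> R) -> R -> Prop :=
  | canonical_ini : forall a s, A a -> ini_bump A a -> s_of A a s -> canonical A a s
  | canonical_prv : forall a b t, A a -> A b -> prv_bump A a b ->
      canonical A b t -> canonical A a (b t).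

Definition cmark (A : (R -> R) -> Prop) (a : R -> R) : R :=
  epsilon (inhabits 0) (canonical A a).

Section Canonical.

Variables (A : (R -> R) -> Prop) (L : list (R -> R)) (m : (R -> R) -> R).
Hypothesis Apos : forall a, A a -> pos_bump a.
Hypothesis Aproper : geom_proper A.
Hypothesis Lfin : forall a, A a -> In a L.
Hypothesis Hm : fast_marking A m.

Lemma A_bump (a : R -> R) : A a -> bump a.
Proof. intros Ha. apply Apos; auto. Qed.

Lemma A_incbij (a : R -> R) : A a -> incbij a.
Proof. intros Ha. apply homeo_plus_incbij. apply Apos; auto. Qed.

Lemma A_lend_rend (a : R -> R) : A a -> lend a < rend a.
Proof. intros Ha. apply (bump_orbital a (A_bump a Ha)). Qed.

Lemma A_fix_ends (a : R -> R) : A a -> a (lend a) = lend a /\ a (rend a) = rend a.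
Proof. intros Ha. destruct (bump_orbital a (A_bump a Ha)) as (_ & _ & _ & H1 & H2 & _). auto. Qed.

Lemma A_pos (a : R -> R) (t : R) : A a -> lend a < t < rend a -> t < a t /\ a t < rend a.
Proof.
  intros Ha Ht. split.
  - apply Apos; auto. apply bump_supt; auto. now apply A_bump.
  - destruct (A_fix_ends a Ha) as [_ E]. rewrite <- E. apply (A_incbij a Ha). lra.
Qed.

Lemma lend_inj (a b : R -> R) : A a -> A b -> lend a = lend b -> a = b.
Proof.
  intros Ha Hb E. apply (proj1 Aproper (lend a)); auto; apply bump_left_tp; auto;
    now apply A_bump.
Qed.

Lemma rend_inj (a b : R -> R) : A a -> A b -> rend a = rend b -> a = b.
Proof.
  intros Ha Hb E. apply (proj2 Aproper (rend a)); auto; apply bump_right_tp; auto;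
    now apply A_bump.
Qed.

Lemma marker_supt (a : R -> R) : A a -> lend a < m a < rend a.
Proof. intros Ha. apply bump_supt; [now apply A_bump|]. now apply Hm. Qed.

Lemma foot_spec (a : R -> R) (k : bool) (s : R) :
  A a -> (foot m (a, k) s <-> if k then lend a < s < m a else a (m a) <= s < rend a).
Proof.
  intros Ha. pose proof (bump_orbital a (A_bump a Ha)) as Ho. simpl. split.
  - intros (x & y & Ho' & H). apply bump_orbital_eq in Ho'; [|now apply A_bump].
    destruct Ho'; subst. exact H.
  - intros H. exists (lend a), (rend a). auto.
Qed.

Lemma marker_src (a b : R -> R) : A a -> A b -> lend a < lend b -> m a <= lend b.
Proof.
  intros Ha Hb C. apply Rnot_lt_le. intros X.
  pose proof (marker_supt a Ha). pose proof (marker_supt b Hb).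
  (* A point common to both sources; the next two lemmas produce a common point of two feet in the
     same way. *)
  set (s := (lend b + Rmin (m a) (m b)) / 2).
  pose proof (Rmin_l (m a) (m b)). pose proof (Rmin_r (m a) (m b)).
  assert (lend b < Rmin (m a) (m b)) by (apply Rmin_glb_lt; lra).
  apply (proj2 Hm (a, true) (b, true) Ha Hb) with s.
  - intros E. inversion E. subst. lra.
  - rewrite !foot_spec by auto. unfold s. lra.
Qed.

Lemma marker_dst (a b : R -> R) : A a -> A b -> rend a < rend b -> rend a <= b (m b).
Proof.
  intros Ha Hb C. apply Rnot_lt_le. intros X.
  pose proof (A_pos a (m a) Ha (marker_supt a Ha)).
  pose proof (A_pos b (m b) Hb (marker_supt b Hb)).
  set (s := (Rmax (a (m a)) (b (m b)) + rend a) / 2).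
  pose proof (Rmax_l (a (m a)) (b (m b))). pose proof (Rmax_r (a (m a)) (b (m b))).
  assert (Rmax (a (m a)) (b (m b)) < rend a) by (apply Rmax_lub_lt; lra).
  apply (proj2 Hm (a, false) (b, false) Ha Hb) with s.
  - intros E. inversion E. subst. lra.
  - rewrite !foot_spec by auto. unfold s. lra.
Qed.

Lemma marker_src_dst (a b : R -> R) : A a -> A b -> lend a < rend b -> m a <= b (m b).
Proof.
  intros Ha Hb C. apply Rnot_lt_le. intros X.
  pose proof (A_pos a (m a) Ha (marker_supt a Ha)). pose proof (marker_supt a Ha).
  pose proof (A_pos b (m b) Hb (marker_supt b Hb)).
  set (lo := Rmax (lend a) (b (m b))). set (hi := Rmin (m a) (rend b)).
  pose proof (Rmax_l (lend a) (b (m b))). pose proof (Rmax_r (lend a) (b (m b))).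
  pose proof (Rmin_l (m a) (rend b)). pose proof (Rmin_r (m a) (rend b)).
  assert (lo < hi) by (apply Rmin_glb_lt; apply Rmax_lub_lt; lra).
  apply (proj2 Hm (a, true) (b, false) Ha Hb) with ((lo + hi) / 2).
  - intros E. inversion E.
  - rewrite !foot_spec by auto. unfold lo, hi in *. lra.
Qed.

(** * Least transition points and initial bumps in terms of ends *)

Lemma tpA_spec (t : R) : tpA A t <-> exists c, A c /\ (t = lend c \/ t = rend c).
Proof.
  unfold tpA. split; intros (c & Hc & H); exists c; split; auto;
    rewrite bump_left_tp, bump_right_tp in * by (now apply A_bump); auto.
Qed.

Lemma isolated_spec (a c : R -> R) :
  A a -> A c -> isolated A a -> ~ lend a < lend c < rend a /\ ~ lend a < rend c < rend a.
Proof.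
  intros Ha Hc Hi. split; intros X; apply Hi; eexists; rewrite bump_supt, tpA_spec
    by (now apply A_bump); eauto.
Qed.

Lemma isolated_ini (a : R -> R) : A a -> isolated A a -> ini_bump A a.
Proof.
  intros Ha Hi c Hc X. exfalso. now apply (isolated_spec a c Ha Hc Hi).
Qed.

Lemma least_tp_spec (a : R -> R) (s : R) :
  A a -> (least_tp A a s <->
    lend a < s < rend a /\ (exists c, A c /\ (s = lend c \/ s = rend c)) /\
    (forall c, A c -> lend a < lend c -> s <= lend c) /\
    (forall c, A c -> lend a < rend c -> s <= rend c)).
Proof.
  intros Ha. unfold least_tp. rewrite bump_supt, tpA_spec by (now apply A_bump). split.
  - intros (H1 & H2 & H3). repeat split; try tauto; intros c Hc X.
    + destruct (Rlt_le_dec (lend c) (rend a)) as [Y|Y]; [|lra].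
      apply H3; [apply bump_supt; [now apply A_bump|lra]|]. apply tpA_spec. eauto.
    + destruct (Rlt_le_dec (rend c) (rend a)) as [Y|Y]; [|lra].
      apply H3; [apply bump_supt; [now apply A_bump|lra]|]. apply tpA_spec. eauto.
  - intros (H1 & H2 & H3 & H4). split; auto. split; auto. intros t Ht Htp.
    apply bump_supt in Ht; [|now apply A_bump]. apply tpA_spec in Htp.
    destruct Htp as (c & Hc & [->| ->]); [apply H3|apply H4]; auto; lra.
Qed.

Lemma least_tp_exists (a : R -> R) :
  A a -> ~ isolated A a -> exists s, least_tp A a s.
Proof.
  intros Ha Hn. apply NNPP in Hn. destruct Hn as (t & Ht & Htp).
  apply tpA_spec in Htp. destruct Htp as (c & Hc & Hct).
  destruct (list_min (fun s : R => s) (fun s => supt a s /\ tpA A s)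
              (map lend L ++ map rend L)) as (s & _ & [H1 H2] & H3).
  - exists t. rewrite in_app_iff, tpA_spec. split; [|eauto].
    destruct Hct as [->| ->]; [left|right]; apply in_map; auto.
  - exists s. split; auto. split; auto. intros u Hu Htu. apply H3; auto.
    rewrite in_app_iff. apply tpA_spec in Htu. destruct Htu as (d & Hd & [->| ->]);
      [left|right]; apply in_map; auto.
Qed.

Lemma initial_spec (a : R -> R) : A a -> (initial A a <-> ini_bump A a).
Proof.
  intros Ha. split.
  - intros [Hi|(s & Hs & Hn)]; [now apply isolated_ini|].
    apply least_tp_spec in Hs; auto. destruct Hs as (H1 & (b & Hb & Hsb) & H3 & H4).
    intros c Hc Hca. exists b. split; auto.
    assert (s <> rend b).
    { intros E. apply Hn. exists b. split; auto. apply bump_right_tp; auto. now apply A_bump. }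
    assert (s = lend b) by tauto.
    assert (s <= rend c) by (apply H4; auto; lra).
    assert (s <> rend c); [|lra].
    intros E. apply Hn. exists c. split; auto. apply bump_right_tp; auto. now apply A_bump.
  - intros Hi. destruct (classic (isolated A a)) as [Hs|Hs]; [now left|right].
    destruct (least_tp_exists a Ha Hs) as [s Hl]. exists s. split; auto.
    intros (b & Hb & Hr). apply bump_right_tp in Hr; [|now apply A_bump]. subst s.
    apply least_tp_spec in Hl; auto. destruct Hl as (H1 & _ & H3 & _).
    destruct (Hi b Hb H1) as (c & Hc & Hcb). specialize (H3 c Hc). lra.
Qed.

Lemma s_of_exists (a : R -> R) : A a -> exists s, s_of A a s.
Proof.
  intros Ha. unfold s_of. destruct (classic (isolated A a)) as [Hs|Hs].
  - exists ((lend a + rend a) / 2). left. split; auto. exists (lend a), (rend a).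
    split; auto. apply bump_orbital. now apply A_bump.
  - destruct (least_tp_exists a Ha Hs) as [s Hl]. eauto.
Qed.

Lemma s_of_unique (a : R -> R) (s s' : R) : A a -> s_of A a s -> s_of A a s' -> s = s'.
Proof.
  intros Ha [[Hi (x & y & Ho & E)]|[Hi Hl]] [[Hi' (x' & y' & Ho' & E')]|[Hi' Hl']];
    try contradiction.
  - apply bump_orbital_eq in Ho, Ho'; try (now apply A_bump).
    destruct Ho, Ho'. subst. reflexivity.
  - destruct Hl as (H1 & H2 & H3), Hl' as (H1' & H2' & H3').
    apply Rle_antisym; auto.
Qed.

(** The inequality with right ends is strict because the least transition point in the support of an
    initial bump is no right end; an isolated bump has no end in its support at all. *)
Lemma s_of_ini (a : R -> R) (s : R) :
  A a -> ini_bump A a -> s_of A a s ->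
  lend a < s < rend a /\
  (forall c, A c -> lend a < lend c -> s <= lend c) /\
  (forall c, A c -> lend a < rend c -> s < rend c) /\
  (isolated A a \/ exists c, A c /\ lend a < lend c /\ s = lend c).
Proof.
  intros Ha Hi Hs. pose proof (A_lend_rend a Ha).
  destruct Hs as [[His (x & y & Ho & E)]|[His Hl]].
  - apply bump_orbital_eq in Ho; [|now apply A_bump]. destruct Ho; subst.
    split; [lra|]. split; [|split]; auto; intros c Hc X;
      destruct (isolated_spec a c Ha Hc His) as [Y Z]; lra.
  - pose proof (proj2 (initial_spec a Ha) Hi) as [X|(s' & Hl' & Hn)]; [contradiction|].
    assert (s = s') as <- by (apply (s_of_unique a); auto; right; auto).
    apply least_tp_spec in Hl; auto. destruct Hl as (H1 & (b & Hb & Hsb) & H3 & H4).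
    assert (N : forall c, A c -> s <> rend c).
    { intros c Hc E. apply Hn. exists c. split; auto. apply bump_right_tp; auto.
      now apply A_bump. }
    split; auto. split; auto. split.
    + intros c Hc X. specialize (N c Hc). specialize (H4 c Hc X). lra.
    + right. exists b. specialize (N b Hb).
      assert (s = lend b) by tauto. split; auto. split; auto. lra.
Qed.

Lemma prv_exists (a : R -> R) :
  A a -> ~ ini_bump A a -> exists b, A b /\ prv_bump A a b.
Proof.
  intros Ha Hn. apply not_all_ex_not in Hn. destruct Hn as [c Hn].
  apply imply_to_and in Hn. destruct Hn as [Hc Hn].
  apply imply_to_and in Hn. destruct Hn as [Hca Hn].
  (* The right end of c is preceded by no left end in the support; the least right end there
     inherits this. *)
  destruct (list_min rend (fun c => A c /\ lend a < rend c < rend a) L)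
    as (b & _ & [Hb Hba] & Mb); [eauto|].
  exists b. split; auto. split; auto. split.
  - intros d Hd X. apply Rnot_lt_le. intros Y. apply Hn. exists d. split; auto.
    specialize (Mb c (Lfin c Hc) (conj Hc Hca)). lra.
  - intros d Hd X. destruct (Rlt_le_dec (rend d) (rend a)); [|lra]. apply Mb; auto.
Qed.

Lemma prv_not_ini (a b : R -> R) : A b -> prv_bump A a b -> ~ ini_bump A a.
Proof.
  intros Hb (H1 & H2 & _) Hi. destruct (Hi b Hb H1) as (c & Hc & Hcb).
  specialize (H2 c Hc). lra.
Qed.

Lemma prv_lend (a b : R -> R) : A a -> A b -> prv_bump A a b -> lend b < lend a.
Proof.
  intros Ha Hb (H1 & H2 & H3). pose proof (A_lend_rend b Hb).
  destruct (Rtotal_order (lend b) (lend a)) as [C|[C|C]]; auto; exfalso.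
  - apply lend_inj in C; auto. subst. lra.
  - specialize (H2 b Hb C). lra.
Qed.

(** * The canonical marking and disjointness of its feet *)

Lemma canonical_unique (a : R -> R) (t t' : R) :
  canonical A a t -> canonical A a t' -> t = t'.
Proof.
  intros H. revert t'. induction H as [a s Ha Hi Hs | a b t Ha Hb Hp H IH]; intros t' H'.
  - inversion H' as [a' s' Ha' Hi' Hs' | a' b t0 Ha' Hb Hp H0]; subst.
    + now apply (s_of_unique a).
    + exfalso. now apply (prv_not_ini a b Hb Hp).
  - inversion H' as [a' s' Ha' Hi' Hs' | a' b' t0 Ha' Hb' Hp' H0]; subst.
    + exfalso. now apply (prv_not_ini a b Hb Hp).
    + assert (b = b') as <-; [|f_equal; auto].
      destruct Hp as (P1 & P2 & P3), Hp' as (Q1 & Q2 & Q3).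
      apply rend_inj; auto. apply Rle_antisym; [apply P3|apply Q3]; auto; lra.
Qed.

Lemma canonical_exists (a : R -> R) : A a -> exists t, canonical A a t.
Proof.
  intros Ha. apply NNPP. intros Hn.
  destruct (list_min lend (fun a => A a /\ ~ exists t, canonical A a t) L)
    as (b & _ & [Hb Nb] & Mb); [eauto|].
  destruct (classic (ini_bump A b)) as [Hi|Hi].
  - destruct (s_of_exists b Hb) as [s Hs]. apply Nb. exists s. now apply canonical_ini.
  - destruct (prv_exists b Hb Hi) as (c & Hc & Hp).
    destruct (classic (exists t, canonical A c t)) as [[t Ht]|Nc].
    + apply Nb. exists (c t). now apply canonical_prv.
    + specialize (Mb c (Lfin c Hc) (conj Hc Nc)). pose proof (prv_lend b c Hb Hc Hp). lra.
Qed.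

Lemma cmark_canonical (a : R -> R) : A a -> canonical A a (cmark A a).
Proof. intros Ha. apply (epsilon_spec (inhabits 0) (canonical A a)). now apply canonical_exists. Qed.

Lemma cmark_prv (a b : R -> R) : A a -> A b -> prv_bump A a b -> cmark A a = b (cmark A b).
Proof.
  intros Ha Hb Hp. apply (canonical_unique a); [now apply cmark_canonical|].
  apply canonical_prv; auto. now apply cmark_canonical.
Qed.

Lemma cmark_s_of (a : R -> R) : A a -> ini_bump A a -> s_of A a (cmark A a).
Proof.
  intros Ha Hi. destruct (s_of_exists a Ha) as [s Hs].
  rewrite (canonical_unique a (cmark A a) s); auto.
  - now apply cmark_canonical.
  - now apply canonical_ini.
Qed.

(** Compared with the given fast marking m, the canonical marker of a non-isolated bump moves right,
    so its destination shrinks and stays disjoint from the others. Its source cannot grow past the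
    next left end. *)
Lemma canonical_bounds (a : R -> R) (t : R) :
  canonical A a t ->
  lend a < t < rend a /\ (forall c, A c -> lend a < lend c -> t <= lend c) /\
  (isolated A a \/ m a <= t).
Proof.
  intros H. induction H as [a s Ha Hi Hs | a b t Ha Hb Hp H IH].
  - destruct (s_of_ini a s Ha Hi Hs) as (H1 & H2 & H3 & H4). split; auto. split; auto.
    destruct H4 as [H4|(c & Hc & Hac & ->)]; auto. right. now apply marker_src.
  - destruct IH as (I1 & I2 & I3). pose proof Hp as (P1 & P2 & P3).
    pose proof (A_pos b t Hb I1) as Ht. pose proof (prv_lend a b Ha Hb Hp) as Hba.
    assert (Hmb : m b <= t).
    { destruct I3 as [I3|I3]; auto. exfalso.
      apply (proj1 (isolated_spec b a Hb Ha I3)). lra. }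
    (* The source of a precedes the destination of b for m, and the destination of b only
       shrinks. *)
    assert (Hma : m a <= b t).
    { apply Rle_trans with (b (m b)).
      - apply marker_src_dst; auto. lra.
      - apply incbij_le; auto. now apply A_incbij. }
    pose proof (marker_supt a Ha). split; [lra|]. split; auto.
    intros c Hc X. specialize (P2 c Hc X). lra.
Qed.

Lemma cmark_supt (a : R -> R) : A a -> lend a < cmark A a < rend a.
Proof. intros Ha. apply (canonical_bounds a). now apply cmark_canonical. Qed.

Lemma cmark_src (a b : R -> R) : A a -> A b -> lend a < lend b -> cmark A a <= lend b.
Proof. intros Ha Hb. apply (canonical_bounds a); auto. now apply cmark_canonical. Qed.

Lemma cmark_image_ge (b : R -> R) :
  A b -> isolated A b \/ b (m b) <= b (cmark A b).
Proof.
  intros Hb. destruct (canonical_bounds b _ (cmark_canonical b Hb)) as (_ & _ & [H|H]); auto.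
  right. apply incbij_le; auto. now apply A_incbij.
Qed.

Lemma cmark_dst (a b : R -> R) :
  A a -> A b -> rend a < rend b -> rend a <= b (cmark A b).
Proof.
  intros Ha Hb C. pose proof (cmark_supt b Hb) as Hs. pose proof (A_pos b _ Hb Hs).
  destruct (cmark_image_ge b Hb) as [Hi|Hi].
  - destruct (isolated_spec b a Hb Ha Hi) as [_ X]. lra.
  - pose proof (marker_dst a b Ha Hb C). lra.
Qed.

Lemma cmark_ini (a b : R -> R) :
  A a -> A b -> ini_bump A a -> lend a < rend b -> cmark A a < b (cmark A b).
Proof.
  intros Ha Hb Hi C. pose proof (cmark_supt b Hb) as Hs. pose proof (A_pos b _ Hb Hs).
  pose proof (cmark_supt a Ha) as Hsa.
  destruct (s_of_ini a _ Ha Hi (cmark_s_of a Ha Hi)) as (H1 & H2 & H3 & [H4|(c & Hc & Hac & E)]).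
  - destruct (isolated_spec a b Ha Hb H4) as [_ X].
    destruct (Rtotal_order (rend a) (rend b)) as [Y|[Y|Y]]; [|apply rend_inj in Y; auto; subst; lra|lra].
    pose proof (cmark_dst a b Ha Hb Y). lra.
  - rewrite E. specialize (H3 b Hb C). rewrite E in H3.
    destruct (cmark_image_ge b Hb) as [I|I].
    + destruct (isolated_spec b c Hb Hc I) as [X _]. lra.
    + pose proof (marker_src_dst c b Hc Hb H3). pose proof (marker_supt c Hc). lra.
Qed.

Lemma cmark_src_dst (a b : R -> R) :
  A a -> A b -> lend a < rend b -> cmark A a <= b (cmark A b).
Proof.
  intros Ha Hb C. destruct (classic (ini_bump A a)) as [Hi|Hi].
  - left. now apply cmark_ini.
  (* The marker of a starts the destination of its predecessor c, whose right end is the first one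
     beyond [lend a]. *)
  - destruct (prv_exists a Ha Hi) as (c & Hc & Hp). rewrite (cmark_prv a c Ha Hc Hp).
    destruct Hp as (P1 & P2 & P3). specialize (P3 b Hb C).
    destruct P3 as [P3|P3].
    + pose proof (cmark_dst c b Hc Hb P3).
      pose proof (A_pos c _ Hc (cmark_supt c Hc)). lra.
    + apply rend_inj in P3; auto. subst. lra.
Qed.

(** In this and the next three lemmas, disjoint nonempty feet are ordered like their transition
    points, whatever fast marking is chosen; hence a diagram isomorphism preserves comparisons of
    ends. *)
Lemma foot_lt_src (a b : R -> R) :
  A a -> A b -> (foot_lt m (a, true) (b, true) <-> lend a < lend b).
Proof.
  intros Ha Hb. pose proof (marker_supt a Ha). pose proof (marker_supt b Hb).
  split.
  - intros H1. specialize (H1 ((lend a + m a) / 2) ((lend b + m b) / 2)).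
    rewrite !foot_spec in H1 by auto.
    destruct (Rtotal_order (lend a) (lend b)) as [C|[C|C]]; auto.
    + apply lend_inj in C; auto. subst. lra.
    + pose proof (marker_src b a Hb Ha C). lra.
  - intros C s t Hs Ht. rewrite foot_spec in Hs, Ht by auto.
    pose proof (marker_src a b Ha Hb C). lra.
Qed.

Lemma foot_lt_dst (a b : R -> R) :
  A a -> A b -> (foot_lt m (a, false) (b, false) <-> rend a < rend b).
Proof.
  intros Ha Hb. pose proof (A_pos a _ Ha (marker_supt a Ha)).
  pose proof (A_pos b _ Hb (marker_supt b Hb)). split.
  - intros H1. specialize (H1 (a (m a)) (b (m b))).
    rewrite !foot_spec in H1 by auto.
    destruct (Rtotal_order (rend a) (rend b)) as [C|[C|C]]; auto.
    + apply rend_inj in C; auto. subst. lra.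
    + pose proof (marker_dst b a Hb Ha C). lra.
  - intros C s t Hs Ht. rewrite foot_spec in Hs, Ht by auto.
    pose proof (marker_dst a b Ha Hb C). lra.
Qed.

Lemma foot_lt_src_dst (a b : R -> R) :
  A a -> A b -> (foot_lt m (a, true) (b, false) <-> lend a < rend b).
Proof.
  intros Ha Hb. pose proof (marker_supt a Ha). pose proof (A_pos b _ Hb (marker_supt b Hb)).
  split.
  - intros H1. specialize (H1 ((lend a + m a) / 2) (b (m b))).
    rewrite !foot_spec in H1 by auto. lra.
  - intros C s t Hs Ht. rewrite foot_spec in Hs, Ht by auto.
    pose proof (marker_src_dst a b Ha Hb C). lra.
Qed.

Lemma foot_lt_dst_src (a b : R -> R) :
  A a -> A b -> (foot_lt m (b, false) (a, true) <-> rend b <= lend a).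
Proof.
  intros Ha Hb. pose proof (marker_supt a Ha). pose proof (A_pos b _ Hb (marker_supt b Hb)).
  split.
  - intros H1. specialize (H1 (b (m b)) ((lend a + m a) / 2)).
    rewrite !foot_spec in H1 by auto. apply Rnot_lt_le. intros C.
    pose proof (marker_src_dst a b Ha Hb C). lra.
  - intros C s t Hs Ht. rewrite foot_spec in Hs, Ht by auto. lra.
Qed.

End Canonical.

(** * Diagram isomorphisms *)

Lemma label_in (X : (R -> R) -> Prop) (f : R -> R) : label X f -> X f.
Proof. intros (u & v & H & _). exact H. Qed.

Lemma carries_edge (X : (R -> R) -> Prop) (f a : R -> R) (k : bool) :
  X f -> pos_bump a -> carries f a k -> edge X (a, k) (a, negb k) f.
Proof.
  intros Hf Ha Hc. split; auto. exists a. split; auto. destruct k; simpl in *; auto.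
Qed.

Lemma edge_carries (X : (R -> R) -> Prop) (f a : R -> R) (k : bool) (v : (R -> R) * bool) :
  edge X (a, k) v f -> pos_bump a /\ carries f a k /\ v = (a, negb k).
Proof.
  intros [_ (b & Hb & [(H1 & E1 & E2)|(H1 & E1 & E2)])]; inversion E1; subst; auto.
Qed.

Lemma carries_used (X : (R -> R) -> Prop) (f a : R -> R) (k : bool) :
  X f -> pos_bump a -> carries f a k -> used X a.
Proof. intros Hf Ha Hc. split; auto. exists f. destruct k; auto. Qed.

Lemma used_carries (X : (R -> R) -> Prop) (a : R -> R) :
  used X a -> exists f k, X f /\ carries f a k.
Proof.
  intros [_ (f & Hf & [H|H])]; [exists f, true|exists f, false]; auto.
Qed.

Lemma label_or_id (X : (R -> R) -> Prop) (f : R -> R) :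
  homeo_plus f -> X f -> label X f \/ f = (fun t => t).
Proof.
  intros Hf HX. destruct (classic (label X f)) as [H|H]; auto. right.
  apply functional_extensionality. intros p. apply NNPP. intros Hp.
  assert (Hs : supt f p).
  { split; auto. apply NNPP. intros Hn. apply Hp. now apply Hf. }
  destruct (supt_carries f p Hf Hs) as (a & k & Ha & Hc & _).
  apply H. exists (a, k), (a, negb k). now apply carries_edge.
Qed.

(** A used bump is determined by its left end, which is a transition point of an element of X. *)
Lemma used_finite (X : (R -> R) -> Prop) :
  (forall f, X f -> homeo_plus f) -> geom_proper (used X) -> finitely_many_tp X ->
  exists L, forall a, used X a -> In a L.
Proof.
  intros HX Hp [l Hl].
  assert (H : forall l' : list R, exists L, forall a, used X a -> In (lend a) l' -> In a L).
  { induction l' as [|x l' [L IH]]; [exists []; auto|].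
    destruct (classic (exists a, used X a /\ lend a = x)) as [(b & Hb & Eb)|Hn].
    - exists (b :: L). intros a Ha [E|E]; [left|right; auto].
      apply (lend_inj (used X)); auto; [intros c Hc; apply Hc|congruence].
    - exists L. intros a Ha [E|E]; auto. exfalso. eauto. }
  destruct (H l) as [L HL]. exists L. intros a Ha. apply HL; auto. apply Hl.
  destruct (used_carries X a Ha) as (f & k & Hf & Hc).
  exists f. split; auto. left. apply (carries_left_tp f a k); auto. apply Ha.
Qed.

Record transport (X Y : (R -> R) -> Prop) (i t : (R -> R) -> (R -> R)) : Prop := {
  tr_used : forall a, used X a -> used Y (i a);
  tr_inj : forall a b, used X a -> used X b -> i a = i b -> a = b;
  tr_surj : forall b, used Y b -> exists a, used X a /\ i a = b;
  tr_label : forall f, label X f -> label Y (t f);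
  tr_carries : forall f a k, label X f -> used X a -> carries f a k -> carries (t f) (i a) k;
  tr_carries_inv : forall f a k, label X f -> used X a -> carries (t f) (i a) k -> carries f a k;
  tr_lend : forall a b, used X a -> used X b -> (lend a < lend b <-> lend (i a) < lend (i b));
  tr_rend : forall a b, used X a -> used X b -> (rend a < rend b <-> rend (i a) < rend (i b));
  tr_lend_rend : forall a b, used X a -> used X b ->
    (lend a < rend b <-> lend (i a) < rend (i b)) }.

Lemma transport_id (X : (R -> R) -> Prop) : transport X X (fun a => a) (fun f => f).
Proof. split; auto; try tauto. eauto. Qed.

Definition diagram_of (X : (R -> R) -> Prop) : diagram (I := R -> R) (J := R -> R) :=
  {| isbump := used X; islabel := label X;
     incid := fun f a k => label X f /\ carries f a k;
     ini := ini_bump (used X); prv := prv_bump (used X) |}.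

(** The dynamics of Y indexed by the bumps and labels of X. With identity maps this is X itself, so
    [transport_realizes] serves both sides. *)
Definition system_of (Y : (R -> R) -> Prop) (i t : (R -> R) -> (R -> R)) :
    system (I := R -> R) (J := R -> R) :=
  {| gact := t; bmp := i; lft := fun a => lend (i a);
     mrk := fun a => cmark (used Y) (i a); img := fun a => i a (cmark (used Y) (i a));
     rgt := fun a => rend (i a) |}.

Lemma used_pos (X : (R -> R) -> Prop) (a : R -> R) : used X a -> pos_bump a.
Proof. intros H. apply H. Qed.

Section Transport.

Variables (X Y : (R -> R) -> Prop) (i t : (R -> R) -> (R -> R)).
Variables (LX LY : list (R -> R)) (m : (R -> R) -> R).
Hypothesis tr : transport X Y i t.
Hypothesis LXfin : forall a, used X a -> In a LX.
Hypothesis LYfin : forall a, used Y a -> In a LY.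
Hypothesis Yhomeo : forall f, Y f -> homeo_plus f.
Hypothesis Yproper : geom_proper (used Y).
Hypothesis Ymark : fast_marking (used Y) m.

Lemma transport_ini (a : R -> R) :
  used X a -> (ini_bump (used X) a <-> ini_bump (used Y) (i a)).
Proof.
  intros Ha. split; intros Hi c Hc [H1 H2].
  - destruct (tr_surj _ _ _ _ tr c Hc) as (c0 & Hc0 & <-).
    apply (tr_lend_rend _ _ _ _ tr) in H1; auto. apply (tr_rend _ _ _ _ tr) in H2; auto.
    destruct (Hi c0 Hc0 (conj H1 H2)) as (b & Hb & B1 & B2).
    exists (i b). split; [now apply (tr_used _ _ _ _ tr)|].
    apply (tr_lend _ _ _ _ tr) in B1; auto. apply (tr_lend_rend _ _ _ _ tr) in B2; auto.
  - apply (tr_lend_rend _ _ _ _ tr) in H1; auto. apply (tr_rend _ _ _ _ tr) in H2; auto.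
    destruct (Hi (i c) (tr_used _ _ _ _ tr c Hc) (conj H1 H2)) as (b & Hb & B1 & B2).
    destruct (tr_surj _ _ _ _ tr b Hb) as (b0 & Hb0 & <-).
    exists b0. split; auto.
    apply (tr_lend _ _ _ _ tr) in B1; auto. apply (tr_lend_rend _ _ _ _ tr) in B2; auto.
Qed.

Lemma transport_prv (a b : R -> R) :
  used X a -> used X b -> prv_bump (used X) a b -> prv_bump (used Y) (i a) (i b).
Proof.
  intros Ha Hb ([H1 H2] & H3 & H4). split; [|split].
  - split; [now apply (proj1 (tr_lend_rend _ _ _ _ tr a b Ha Hb))|].
    now apply (proj1 (tr_rend _ _ _ _ tr b a Hb Ha)).
  - intros c Hc C. destruct (tr_surj _ _ _ _ tr c Hc) as (c0 & Hc0 & <-).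
    apply (tr_lend _ _ _ _ tr) in C; auto. apply Rnot_lt_le. intros Z.
    apply (tr_lend_rend _ _ _ _ tr) in Z; auto. specialize (H3 c0 Hc0 C). lra.
  - intros c Hc C. destruct (tr_surj _ _ _ _ tr c Hc) as (c0 & Hc0 & <-).
    apply (tr_lend_rend _ _ _ _ tr) in C; auto. apply Rnot_lt_le. intros Z.
    apply (tr_rend _ _ _ _ tr) in Z; auto. specialize (H4 c0 Hc0 C). lra.
Qed.

Lemma transport_realizes : realizes (diagram_of X) (system_of Y i t).
Proof.
  pose proof (used_pos Y) as Ypos. pose proof (tr_used _ _ _ _ tr) as Hu.
  split; simpl.
  - intros a Ha.
    pose proof (cmark_supt (used Y) LY m Ypos Yproper LYfin Ymark (i a) (Hu a Ha)).
    pose proof (A_pos (used Y) Ypos (i a) (cmark (used Y) (i a)) (Hu a Ha)). lra.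
  - intros a b Ha Hb E. apply (tr_inj _ _ _ _ tr); auto. now apply (lend_inj (used Y)); auto.
  - intros a b Ha Hb E. apply (tr_inj _ _ _ _ tr); auto. now apply (rend_inj (used Y)); auto.
  - intros a b Ha Hb. apply (cmark_src (used Y) LY m); auto.
  - intros a b Ha Hb. apply (cmark_dst (used Y) LY m); auto.
  - intros a b Ha Hb. apply (cmark_src_dst (used Y) LY m); auto.
  - intros a b Ha Hb Hi. apply (cmark_ini (used Y) LY m); auto. now apply transport_ini.
  - intros a Ha Hi. now apply (prv_exists (used X) LX).
  - intros a b Ha Hb Hp. pose proof (transport_prv a b Ha Hb Hp) as Hp'.
    split; [|split].
    + apply (prv_lend (used Y)); auto.
    + apply Hp'.
    + apply (cmark_prv (used Y) LY); auto.
  - intros a Ha. apply (A_incbij (used Y)); auto.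
  - intros a Ha. apply (A_fix_ends (used Y)); auto.
  - intros a Ha. apply (A_fix_ends (used Y)); auto.
  - reflexivity.
  - intros a p Ha Hp. apply (A_pos (used Y)); auto.
  - intros f Hf. apply homeo_plus_incbij, Yhomeo, label_in. now apply (tr_label _ _ _ _ tr).
  - intros f a p Ha [Hf Hc] Hp. apply (tr_carries _ _ _ _ tr f a true Hf Ha Hc).
    apply bump_supt; auto. apply (Ypos (i a)); auto.
  - intros f a p Ha [Hf Hc] Hp. apply (tr_carries _ _ _ _ tr f a false Hf Ha Hc).
    apply bump_supt; auto. apply (Ypos (i a)); auto.
  - intros f p Hf Hp. apply NNPP. intros Hne.
    assert (HY : Y (t f)) by (apply label_in; now apply (tr_label _ _ _ _ tr)).
    assert (Hs : supt (t f) p).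
    { split; auto. apply NNPP. intros Hn. apply Hne. now apply (Yhomeo (t f)). }
    destruct (supt_carries (t f) p (Yhomeo _ HY) Hs) as (b & k & Hb & Hc & Hsb).
    destruct (tr_surj _ _ _ _ tr b (carries_used Y (t f) b k HY Hb Hc)) as (a & Ha & <-).
    apply (Hp a k Ha); [split; auto; now apply (tr_carries_inv _ _ _ _ tr)|].
    apply bump_supt; auto. apply Hb.
Qed.

End Transport.

Lemma diagram_iso_transport (X Y : (R -> R) -> Prop) (mX mY : (R -> R) -> R)
    (beta : (R -> R) * bool -> (R -> R) * bool) (tau : (R -> R) -> (R -> R)) :
  geom_proper (used X) -> geom_proper (used Y) ->
  fast_marking (used X) mX -> fast_marking (used Y) mY ->
  diagram_iso X Y mX mY beta tau ->
  transport X Y (fun a => fst (beta (a, true))) tau.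
Proof.
  intros PX PY MX MY (B1 & B2 & B3 & B4 & B5 & B6 & B7).
  pose proof (used_pos X) as Xpos. pose proof (used_pos Y) as Ypos.
  (* An edge between the feet of a goes to an edge, so both images are feet of one bump; as a source
     precedes its destination, the order forbids an exchange. *)
  assert (Hbeta : forall a k, used X a -> beta (a, k) = (fst (beta (a, true)), k)).
  { assert (H : forall a, used X a -> exists b, used Y b /\ forall k, beta (a, k) = (b, k)).
    { intros a Ha.
      assert (Hlt : foot_lt mY (beta (a, true)) (beta (a, false))).
      { apply B4; auto. apply (foot_lt_src_dst (used X)); auto.
        apply (A_lend_rend (used X)); auto. }
      pose proof (B1 (a, true) Ha) as Hv.
      assert (Hpair : exists b k, beta (a, true) = (b, k) /\ beta (a, false) = (b, negb k)).
      { destruct (used_carries X a Ha) as (f & k & Hf & Hc).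
        pose proof (B5 _ _ _ (carries_edge X f a k Hf (Xpos a Ha) Hc)) as He.
        destruct (beta (a, k)) as [b j] eqn:E. apply edge_carries in He.
        destruct He as (_ & _ & E'). exists b.
        destruct k; simpl in E'; [exists j|exists (negb j)]; rewrite ?E', ?E; auto.
        now rewrite Bool.negb_involutive. }
      destruct Hpair as (b & k & E1 & E2). rewrite E1, E2 in Hlt. rewrite E1 in Hv.
      destruct k; simpl in Hlt.
      - exists b. split; auto. intros []; auto.
      - exfalso. apply (foot_lt_dst_src (used Y)) in Hlt; auto.
        pose proof (A_lend_rend (used Y) Ypos b Hv). lra. }
    intros a k Ha. destruct (H a Ha) as (b & _ & E). now rewrite !E. }
  set (i := fun a => fst (beta (a, true))). fold i.
  assert (Hbeta' : forall a k, used X a -> beta (a, k) = (i a, k)) by exact Hbeta.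
  clearbody i. clear Hbeta.
  assert (Hu : forall a, used X a -> used Y (i a)).
  { intros a Ha. pose proof (B1 (a, true) Ha) as H. now rewrite Hbeta' in H. }
  assert (Hlt : forall a b k l, used X a -> used X b ->
            foot_lt mX (a, k) (b, l) -> foot_lt mY (i a, k) (i b, l)).
  { intros a b k l Ha Hb H. rewrite <- !Hbeta' by auto. now apply B4. }
  split; auto.
  - intros a b Ha Hb E.
    assert (X0 : (a, true) = (b, true)) by (apply B2; auto; rewrite !Hbeta'; congruence).
    congruence.
  - intros b Hb. destruct (B3 (b, true) Hb) as ([a k] & Ha & E).
    exists a. split; auto. rewrite Hbeta' in E by auto. congruence.
  - intros f (u & v & He). exists (beta u), (beta v). auto.
  - intros f a k Hf Ha Hc.
    pose proof (B5 _ _ _ (carries_edge X f a k (label_in X f Hf) (Xpos a Ha) Hc)) as He.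
    rewrite !Hbeta' in He by auto. now apply edge_carries in He.
  - intros f a k Hf Ha Hc.
    assert (HY : Y (tau f)).
    { destruct Hf as (u & v & He). now apply B5 in He as [He _]. }
    pose proof (carries_edge Y (tau f) (i a) k HY (Ypos _ (Hu a Ha)) Hc) as He.
    rewrite <- !Hbeta' in He by auto.
    apply B6 in He; auto. destruct He as (f0 & He & E).
    (* The lifted edge may carry another label a priori; injectivity of [tau] on labels identifies
       it with f. *)
    assert (f0 = f) as <- by (apply B7; auto; do 2 eexists; eauto).
    now apply edge_carries in He.
  - assert (H : forall a b, used X a -> used X b -> lend a < lend b -> lend (i a) < lend (i b)).
    { intros a b Ha Hb C. apply (foot_lt_src (used Y) mY); auto. apply Hlt; auto.
      now apply (foot_lt_src (used X)). }
    intros a b Ha Hb. split; [auto|]. intros C.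
    destruct (Rtotal_order (lend a) (lend b)) as [Z|[Z|Z]]; auto.
    + apply (lend_inj (used X)) in Z; auto. subst. lra.
    + apply H in Z; auto. lra.
  - assert (H : forall a b, used X a -> used X b -> rend a < rend b -> rend (i a) < rend (i b)).
    { intros a b Ha Hb C. apply (foot_lt_dst (used Y) mY); auto. apply Hlt; auto.
      now apply (foot_lt_dst (used X)). }
    intros a b Ha Hb. split; [auto|]. intros C.
    destruct (Rtotal_order (rend a) (rend b)) as [Z|[Z|Z]]; auto.
    + apply (rend_inj (used X)) in Z; auto. subst. lra.
    + apply H in Z; auto. lra.
  - intros a b Ha Hb. split; intros C.
    + apply (foot_lt_src_dst (used Y) mY); auto. apply Hlt; auto.
      now apply (foot_lt_src_dst (used X)).
    + apply Rnot_le_lt. intros Z. apply (foot_lt_dst_src (used X) mX) in Z; auto.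
      apply Hlt in Z; auto. apply (foot_lt_dst_src (used Y)) in Z; auto. lra.
Qed.

Lemma M0_spec (X : (R -> R) -> Prop) (L : list (R -> R)) (s : R) :
  geom_proper (used X) -> (forall a, used X a -> In a L) ->
  (M0 X s <-> exists a, used X a /\ ini_bump (used X) a /\ s = cmark (used X) a).
Proof.
  intros Hp HL. pose proof (used_pos X) as Xpos. split.
  - intros (a & Ha & Hi & Hs). exists a.
    apply (initial_spec (used X) L) in Hi; auto.
    split; auto. split; auto. apply (s_of_unique (used X) Xpos a); auto.
    apply (cmark_s_of (used X) L); auto.
  - intros (a & Ha & Hi & ->). exists a. split; auto.
    split; [apply (initial_spec (used X) L); auto|].
    apply (cmark_s_of (used X) L); auto.
Qed.

(** * The isomorphism and the conjugating order isomorphism *)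

Section Conclusion.

Variables (X Y : (R -> R) -> Prop) (i t : (R -> R) -> (R -> R)).
Variables (LX LY : list (R -> R)) (mX mY : (R -> R) -> R).
Hypothesis tr : transport X Y i t.
Hypothesis LXfin : forall a, used X a -> In a LX.
Hypothesis LYfin : forall a, used Y a -> In a LY.
Hypothesis Xhomeo : forall f, X f -> homeo_plus f.
Hypothesis Yhomeo : forall f, Y f -> homeo_plus f.
Hypothesis Xproper : geom_proper (used X).
Hypothesis Yproper : geom_proper (used Y).
Hypothesis Xmark : fast_marking (used X) mX.
Hypothesis Ymark : fast_marking (used Y) mY.
Hypothesis tr_label_surj : forall g, label Y g -> exists f, label X f /\ t f = g.

Let D := diagram_of X.
Let S := system_of X (fun a => a) (fun f => f).
Let S' := system_of Y i t.

Let rz : realizes D S :=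
  transport_realizes X X (fun a => a) (fun f => f) LX LX mX (transport_id X)
    LXfin LXfin Xhomeo Xproper Xmark.

Let rz' : realizes D S' :=
  transport_realizes X Y i t LX LY mY tr LXfin LYfin Yhomeo Yproper Ymark.

Let cp : compatible D S S'.
Proof.
  intros a b Ha Hb. split; [|split].
  - apply (tr_lend _ _ _ _ tr); auto.
  - apply (tr_rend _ _ _ _ tr); auto.
  - apply (tr_lend_rend _ _ _ _ tr); auto.
Qed.

Lemma words_gen (f g : R -> R) : words D S S' f g -> gen X f /\ gen Y g.
Proof.
  intros H. induction H as [|g g' [f b] x x' H [IH1 IH2] [Hf Hx] [_ Hx']].
  - split; apply gen_id.
  - assert (HX : X f) by now apply label_in.
    assert (HY : Y (t f)) by (apply label_in; now apply (tr_label _ _ _ _ tr)).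
    destruct b; simpl in Hx, Hx'.
    + subst. split; apply gen_mul; auto.
    + destruct Hx, Hx'. split; eapply gen_mulinv; eauto.
Qed.

Lemma gen_words_left (f : R -> R) : gen X f -> exists g, words D S S' f g.
Proof.
  intros H. induction H as [|g x H [g' IH] Hx|g x h H [g' IH] Hx E1 E2].
  - exists (fun t => t). apply words_id.
  - destruct (label_or_id X x (Xhomeo x Hx) Hx) as [Hl| ->]; [|exists g'; exact IH].
    exists (mul g' (t x)). apply (words_mul D S S' _ _ (x, true)); simpl; auto.
  - destruct (label_or_id X x (Xhomeo x Hx) Hx) as [Hl| ->].
    + destruct (letter_exists D S' rz' x false Hl) as [y Hy].
      exists (mul g' y). apply (words_mul D S S' _ _ (x, false)); simpl; auto.
    + exists g'. replace (mul g h) with g; auto.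
      apply functional_extensionality. intros u. unfold mul. now rewrite E1.
Qed.

Lemma gen_words_right (g : R -> R) : gen Y g -> exists f, words D S S' f g.
Proof.
  intros H. induction H as [|g y H [g' IH] Hy|g y h H [g' IH] Hy E1 E2].
  - exists (fun t => t). apply words_id.
  - destruct (label_or_id Y y (Yhomeo y Hy) Hy) as [Hl| ->]; [|exists g'; exact IH].
    destruct (tr_label_surj y Hl) as (x & Hx & <-).
    exists (mul g' x). apply (words_mul D S S' _ _ (x, true)); simpl; auto.
  - destruct (label_or_id Y y (Yhomeo y Hy) Hy) as [Hl| ->].
    + destruct (tr_label_surj y Hl) as (x & Hx & <-).
      destruct (letter_exists D S rz x false Hx) as [z Hz].
      exists (mul g' z). apply (words_mul D S S' _ _ (x, false)); simpl; auto.
    + exists g'. replace (mul g h) with g; auto.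
      apply functional_extensionality. intros u. unfold mul. now rewrite E1.
Qed.

Lemma Mgen_paired_left (p : R) : Mgen X p -> exists q, paired D S S' p q /\ Mgen Y q.
Proof.
  intros (f & s & Hf & Hs & ->).
  apply (M0_spec X LX) in Hs; auto. destruct Hs as (a & Ha & Hi & ->).
  destruct (gen_words_left f Hf) as [g Hg].
  exists (g (cmark (used Y) (i a))). split.
  - apply paired_words; auto. apply (paired_mrk D S S' a); auto.
  - exists g, (cmark (used Y) (i a)). split; [now apply (words_gen f g)|]. split; auto.
    apply (M0_spec Y LY); auto. exists (i a).
    split; [now apply (tr_used _ _ _ _ tr)|]. split; auto.
    now apply (transport_ini X Y i t tr).
Qed.

Lemma Mgen_paired_right (q : R) : Mgen Y q -> exists p, paired D S S' p q /\ Mgen X p.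
Proof.
  intros (g & s & Hg & Hs & ->).
  apply (M0_spec Y LY) in Hs; auto. destruct Hs as (b & Hb & Hi & ->).
  destruct (tr_surj _ _ _ _ tr b Hb) as (a & Ha & <-).
  apply (transport_ini X Y i t tr a Ha) in Hi.
  destruct (gen_words_right g Hg) as [f Hf].
  exists (f (cmark (used X) a)). split.
  - apply paired_words; auto. apply (paired_mrk D S S' a); auto.
  - exists f, (cmark (used X) a). split; [now apply (words_gen f g)|]. split; auto.
    apply (M0_spec X LX); auto. eauto.
Qed.

Lemma transport_conjugacy :
  exists phi : (R -> R) -> (R -> R),
    group_iso X Y phi /\
    (forall f, label X f -> phi f = t f) /\
    exists theta : R -> R,
      (forall p, Mgen X p -> Mgen Y (theta p)) /\
      (forall u, Mgen Y u -> exists p, Mgen X p /\ theta p = u) /\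
      (forall p p', Mgen X p -> Mgen X p' -> p < p' -> theta p < theta p') /\
      (forall f p, gen X f -> Mgen X p -> theta (f p) = (phi f) (theta p)).
Proof.
  (* Both maps are chosen from relations; [words_functional] and the equality part of [paired_lt_eq]
     make the choices forced wherever a partner exists. *)
  set (phi := fun f => epsilon (inhabits (fun u : R => u)) (words D S S' f)).
  set (theta := fun p => epsilon (inhabits 0) (paired D S S' p)).
  assert (Hphi : forall f g, words D S S' f g -> phi f = g).
  { intros f g H. apply (words_functional D S S' LX rz rz' cp LXfin f); auto.
    apply epsilon_spec. eauto. }
  assert (Hphi_words : forall f, gen X f -> words D S S' f (phi f)).
  { intros f Hf. destruct (gen_words_left f Hf) as [g Hg]. now rewrite (Hphi f g Hg). }
  assert (Htheta : forall p q, paired D S S' p q -> theta p = q).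
  { intros p q H. apply (paired_lt_eq D S S' rz rz' cp p (theta p) p q); auto.
    apply (epsilon_spec (inhabits 0) (paired D S S' p)). eauto. }
  exists phi. split; [|split].
  - split; [|split; [|split]].
    + intros f Hf. now apply (words_gen f (phi f)), Hphi_words.
    + intros f g Hf Hg. apply Hphi. apply words_compose; auto.
    + intros f g Hf Hg E.
      (* Injectivity is single-valuedness of the reversed relation. *)
      apply (words_functional D S' S LX rz' rz (compatible_sym D S S' cp) LXfin (phi f)).
      * now apply words_sym, Hphi_words.
      * rewrite E. now apply words_sym, Hphi_words.
    + intros h Hh. destruct (gen_words_right h Hh) as [f Hf]. exists f.
      split; [now apply (words_gen f h)|auto].
  - intros f Hf. apply Hphi. apply (words_letter D S S' (f, true)); simpl; auto.
  - exists theta. split; [|split; [|split]].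
    + intros p Hp. destruct (Mgen_paired_left p Hp) as (q & Hq & HM).
      now rewrite (Htheta p q Hq).
    + intros u Hu. destruct (Mgen_paired_right u Hu) as (p & Hp & HM). eauto.
    + intros p p' Hp Hp' C.
      destruct (Mgen_paired_left p Hp) as (q & Hq & _).
      destruct (Mgen_paired_left p' Hp') as (q' & Hq' & _).
      rewrite (Htheta p q Hq), (Htheta p' q' Hq').
      now apply (paired_lt_eq D S S' rz rz' cp p q p' q').
    + intros f p Hf Hp. destruct (Mgen_paired_left p Hp) as (q & Hq & _).
      rewrite (Htheta p q Hq). apply Htheta. apply paired_words; auto.
Qed.

End Conclusion.

Theorem theorem1p1 :
  forall (X Y : (R -> R) -> Prop),
    (forall f, X f -> homeo_plus f) ->
    (forall g, Y g -> homeo_plus g) ->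
    geom_fast X -> geom_fast Y ->
    finitely_many_tp X -> finitely_many_tp Y ->
    forall (mX mY : (R -> R) -> R),
      fast_marking (used X) mX -> fast_marking (used Y) mY ->
    forall (beta : (R -> R) * bool -> (R -> R) * bool) (tau : (R -> R) -> (R -> R)),
      diagram_iso X Y mX mY beta tau ->
    exists phi : (R -> R) -> (R -> R),
      group_iso X Y phi /\
      (forall f, label X f -> phi f = tau f) /\
      exists theta : R -> R,
        (forall t, Mgen X t -> Mgen Y (theta t)) /\
        (forall u, Mgen Y u -> exists t, Mgen X t /\ theta t = u) /\
        (forall s t, Mgen X s -> Mgen X t -> s < t -> theta s < theta t) /\
        (forall f t, gen X f -> Mgen X t -> theta (f t) = (phi f) (theta t)).
Proof.
  intros X Y HX HY [_ [PX _]] [_ [PY _]] FX FY mX mY MX MY beta tau Hiso.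
  pose proof (diagram_iso_transport X Y mX mY beta tau PX PY MX MY Hiso) as tr.
  destruct (used_finite X HX PX FX) as [LX HLX].
  destruct (used_finite Y HY PY FY) as [LY HLY].
  apply (transport_conjugacy X Y _ tau LX LY mX mY tr); auto.
  destruct Hiso as (_ & _ & B3 & _ & _ & B6 & _).
  (* [tau] reaches every label of Y: both feet of an edge labelled g are lifted, and then the edge
     itself. *)
  intros g (u & v & He). pose proof He as [Hg (a & Ha & Huv)].
  assert (Hv : vertex Y u /\ vertex Y v).
  { unfold vertex. destruct Huv as [(H1 & -> & ->)|(H1 & -> & ->)]; simpl;
      split; split; eauto. }
  destruct (B3 u (proj1 Hv)) as (u0 & Hu0 & <-).
  destruct (B3 v (proj2 Hv)) as (v0 & Hv0 & <-).
  destruct (B6 u0 v0 g Hu0 Hv0 He) as (f & Hf & E).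
  exists f. split; auto. exists u0, v0. exact Hf.
Qed.
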